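(* Let $X$ and $Y$ be $C^\infty$ vector fields on $\mathbb{R}^2$ with $X(0)=Y(0)=0$, each globally asymptotically stable at the origin. Let $Q(p)=\det(X(p),Y(p))$ and $\mathcal{Z}=Q^{-1}(0)$. Assume that the following conditions hold: (G1) if $p\neq 0$ and $Q(p)=0$, then $\nabla Q(p)\neq 0$; (G3) if $p\neq 0$, $Q(p)=0$, and $\nabla Q(p)$ is orthogonal to $X(p)$, then the second derivative of $Q$ at $p$ along $X$ (equivalently, along $Y$) is different from zero. If $\mathcal{Z}$ contains an unbounded inverse component, then the switched system $$\dot q=u\,X(q)+(1-u)\,Y(q),\qquad q\in\mathbb{R}^2,\ u\in[0,1],$$ is unbounded, i.e. there exist $p\in\mathbb{R}^2$ and a measurable $u:[0,\infty)\to[0,1]$ such that $\gamma(p,u,t)$ goes to infinity as $t$ tends to $\mathcal{T}(p,u)$.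
   Context: The components of $\mathcal{Z}$ are, by convention, the connected components of $\mathcal{Z}\setminus\{0\}$. A component $\Gamma$ is called inverse if, for $p\in\Gamma$, the (nonzero, parallel) vectors $X(p)$ and $Y(p)$ have opposite direction; this does not depend on the choice of $p\in\Gamma$. The second derivative of $Q$ at $p$ along $X$ is the iterated Lie derivative $(L_XL_XQ)(p)$, where $L_XQ=\nabla Q\cdot X$. For $p\in\mathbb{R}^2$ and a measurable function $u:[0,\infty)\to[0,1]$, $t\mapsto\gamma(p,u,t)$ denotes the maximal solution of $\dot q(t)=u(t)X(q(t))+(1-u(t))Y(q(t))$ with $\gamma(p,u,0)=p$, and $\mathcal{T}(p,u)\in(0,+\infty]$ is the maximal time such that it is defined on $[0,\mathcal{T}(p,u))$. A vector field is globally asymptotically stable at the origin if the origin is a Lyapunov stable equilibrium and all its integral curves converge to the origin as $t\to+\infty$. *)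

(* Defs.v *)
From HB Require Import structures.
From mathcomp Require Import all_boot all_order all_algebra.
From mathcomp Require Import all_classical all_reals all_analysis.

Set Implicit Arguments.
Unset Strict Implicit.
Unset Printing Implicit Defensive.

Import Order.TTheory GRing.Theory Num.Theory.
Import numFieldNormedType.Exports.

Local Open Scope classical_set_scope.
Local Open Scope ring_scope.

Notation plane R := 'rV[R]_2.

Section Fields.
Variable R : realType.
Implicit Types (X Y : plane R -> plane R) (f g : plane R -> R).

(* As the domain is finite-dimensional, the directional derivatives determine
   the differential, so this is the usual C^k regularity. *)
Fixpoint Ck (k : nat) X : Prop :=
  match k with
  | 0%N => continuous X
  | k'.+1 => (forall p, differentiable X p) /\ (forall v, Ck k' ('D_v X))
  end.

Definition smooth X : Prop := forall k, Ck k X.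

Definition detXY X Y (p : plane R) : R :=
  \det (row_mx (X p)^T (Y p)^T : 'M[R]_2).

Definition dot (v w : plane R) : R := \sum_(i < 2) v 0 i * w 0 i.

Definition grad f (p : plane R) : plane R :=
  \row_(i < 2) 'D_(delta_mx 0 i) f p.

Definition lie X f (p : plane R) : R := dot (grad f p) (X p).

Definition collinear_locus X Y : set (plane R) := [set p | detXY X Y p = 0].

Definition is_component (S C : set (plane R)) : Prop :=
  exists2 p, S p & C = connected_component S p.

(* The components of the collinearity locus are taken away from the origin. *)
Definition locus_component X Y : set (plane R) -> Prop :=
  is_component (collinear_locus X Y `\ 0).

Definition opposite_direction (v w : plane R) : Prop :=
  v != 0 /\ exists2 c : R, 0 < c & w = - c *: v.

Definition inverse_component X Y (C : set (plane R)) : Prop :=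
  locus_component X Y C /\ forall p, C p -> opposite_direction (X p) (Y p).

End Fields.

Section Trajectories.
Variable R : realType.
Implicit Types (X Y : plane R -> plane R) (T : \bar R) (q : R -> plane R).

(* The time interval [0, T), where T may be infinite. *)
Definition times T : set R := [set t | 0 <= t /\ (t%:E < T)%E].

(* [q] is only relevant on [times T]; maximality is non-extendability to the
   right as a solution in the sense of [sol]. *)
Definition maximal (sol : \bar R -> (R -> plane R) -> Prop) T q : Prop :=
  [/\ (0 < T)%E, sol T q &
      forall T' q', (T < T')%E -> (forall t, times T t -> q' t = q t) ->
        ~ sol T' q'].

Definition integral_curve X T q : Prop :=
  {within times T, continuous q} /\
  forall t, times T t -> 0 < t -> is_derive (t : R^o) 1 q (X (q t)).

Definition lyapunov_stable X : Prop :=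
  forall e : R, 0 < e -> exists2 d : R, 0 < d &
    forall T q, maximal (integral_curve X) T q -> `|q 0| < d ->
      forall t, times T t -> `|q t| < e.

Definition globally_attractive X : Prop :=
  forall T q, maximal (integral_curve X) T q ->
    T = +oo%E /\ q t @[t --> +oo%R] --> (0 : plane R).

Definition globally_asymptotically_stable X : Prop :=
  [/\ X 0 = 0, lyapunov_stable X & globally_attractive X].

Definition absolutely_continuous_on (a b : R) q : Prop :=
  forall e : R, 0 < e -> exists2 d : R, 0 < d &
    forall n (x y : 'I_n -> R),
      (forall i, [/\ a <= x i, x i <= y i & y i <= b]) ->
      trivIset setT (fun i => [set s : R | x i < s < y i]) ->
      \sum_(i < n) (y i - x i) < d ->
      \sum_(i < n) `|q (y i) - q (x i)| < e.

Definition admissible (u : R -> R) : Prop :=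
  measurable_fun [set t : R | 0 <= t] u /\
  forall t, 0 <= t -> 0 <= u t <= 1.

(* Solution in the sense of Caratheodory: [u] is merely measurable. *)
Definition switched_solution X Y (p : plane R) (u : R -> R) T q : Prop :=
  [/\ q 0 = p,
      forall t, times T t -> absolutely_continuous_on 0 t q &
      {ae (@lebesgue_measure R), forall t, times T t -> 0 < t ->
        is_derive (t : R^o) 1 q (u t *: X (q t) + (1 - u t) *: Y (q t))}].

Definition switched_trajectory X Y p u T q : Prop :=
  maximal (switched_solution X Y p u) T q.

(* The filter "t tends to T from below". *)
Definition tends_to (T : \bar R) : set_system R :=
  match T with
  | r%:E => at_left r
  | +oo => pinfty_nbhs R
  | -oo => ninfty_nbhs R
  end%E.

Definition switched_unbounded X Y : Prop :=
  exists (p : plane R) (u : R -> R) (T : \bar R) (q : R -> plane R),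
    [/\ admissible u, switched_trajectory X Y p u T q &
        `|q t| @[t --> tends_to T] --> +oo%R].

End Trajectories.

(* Main.v *)
Require Import Defs.
From HB Require Import structures.
From mathcomp Require Import all_boot all_order all_algebra.
From mathcomp Require Import all_classical all_reals all_analysis.
From mathcomp Require Import ring lra.
Set Implicit Arguments.
Unset Strict Implicit.
Unset Printing Implicit Defensive.
Import Order.TTheory GRing.Theory Num.Theory.
Import numFieldNormedType.Exports.
Local Open Scope classical_set_scope.
Local Open Scope ring_scope.
(** On an inverse component [C] of the collinearity locus [Q = 0] the two fields
    point in opposite directions. Just beside such a component the cone spanned
    by [X] and [Y] is almost a half plane, and it contains the forward direction
    of the component on one of its sides and the backward direction on the
    other. The switched system can therefore move along [C] both ways, and the
    idea is to follow [C] to infinity.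

    Locally this is made precise as mutual reachability: near every point [p] of
    [C], any two transversal points of [C], that is, points where the fields are not
    tangent to [C], can be steered to each other without leaving a prescribed
    neighbourhood of [p]. If [p] is itself
    transversal ([transversal_local]), one of the fields moves off [C] to the
    appropriate side, a segment inside the cone follows ([steer_segment]), and
    the other field moves back onto [C]. If [p] is a tangency point
    ([tangency_local]), the nondegeneracy of the second derivative isolates it
    among tangency points and divides [C] near [p] into two arcs of transversal
    points; orbits of [X] and of [Y] that pass [p] on the side of [C] opposite to
    the tangent orbit cross [C] twice, and they join the two arcs in both
    directions ([tangency_link]). That one condition on the second derivative serves both
    fields is [lie_lie_sg].

    Globally, connectedness of [C] replaces a parametrisation. Call two points of [C]
    outside the ball of radius [n] equivalent if the transversal points near
    them can be steered to each other outside this ball. By local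
    controllability, and since transversal points are dense in [C], this is an
    equivalence relation with open classes. As [C] is connected and unbounded
    and meets every sphere around the origin in a compact set, there is a
    nested sequence of unbounded classes ([unbounded_chain]). Steering from one
    class to the next, each time outside a larger ball, and concatenating the
    pieces gives a trajectory that tends to infinity
    ([unbounded_of_steering_chain]).

    Orbits of the fields come from Picard iteration ([local_flow]). *)

(** * Coordinates and first-order calculus in the plane *)
Section Plane.
Variable R : realType.
Implicit Types (v w p q : plane R) (f g : plane R -> R).

Lemma ord2_ind (P : 'I_2 -> Prop) : P 0 -> P 1 -> forall i, P i.
Proof.
move=> P0 P1 [[|[|//]] Hi].
- by rewrite (_ : Ordinal Hi = 0) //; apply: val_inj.
- by rewrite (_ : Ordinal Hi = 1) //; apply: val_inj.
Qed.

Lemma sum_ord2 (F : 'I_2 -> R) : \sum_(i < 2) F i = F 0 + F 1.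
Proof.
rewrite !big_ord_recl big_ord0 addr0; congr (F _ + F _); exact: val_inj.
Qed.

Lemma plane_eq v w : (forall i, v 0 i = w 0 i) -> v = w.
Proof. by move=> H; apply/rowP => i; apply: H. Qed.

Lemma coord_le_norm v i : `|v 0 i| <= `|v|.
Proof.
by rewrite [leRHS]/Num.Def.normr/= mx_normrE; apply: (le_bigmax _ _ (0, i)).
Qed.

Lemma norm_le v (e : R) : 0 <= e -> (forall i, `|v 0 i| <= e) -> `|v| <= e.
Proof.
move=> e0 H; rewrite [leLHS]/Num.Def.normr/= mx_normrE bigmax_le// => -[i j] _.
by rewrite /= ord1.
Qed.

Lemma norm_lt v (e : R) : 0 < e -> (forall i, `|v 0 i| < e) -> `|v| < e.
Proof.
move=> e0 H; rewrite [ltLHS]/Num.Def.normr/= mx_normrE.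
apply: bigmax_lt => // -[i j] _; by rewrite /= ord1.
Qed.

Definition det2 v w : R := v 0 0 * w 0 1 - v 0 1 * w 0 0.

Lemma dot2 v w : dot v w = v 0 0 * w 0 0 + v 0 1 * w 0 1.
Proof. by rewrite /dot sum_ord2. Qed.

Lemma detXY2 (X Y : plane R -> plane R) p : detXY X Y p = det2 (X p) (Y p).
Proof.
rewrite /detXY /det2 (expand_det_row _ 0) sum_ord2 /cofactor !det_mx11 !mxE /=.
have E0 : fintype.split (0 : 'I_(1 + 1)) = inl 0.
  by case: splitP => // k /= E; congr inl; apply: val_inj; rewrite /= -E.
have E1 : fintype.split (1 : 'I_(1 + 1)) = inr 0.
  by case: splitP => k /= E; [case: k E => [[]]|congr inr; apply: val_inj; case: k E => [[]]].
rewrite E0 E1 !mxE.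
have -> : lift (0 : 'I_2) (0 : 'I_1) = 1 :> 'I_2 by apply: val_inj.
have -> : lift (1 : 'I_2) (0 : 'I_1) = 0 :> 'I_2 by apply: val_inj.
rewrite E0 E1 !mxE /=; ring.
Qed.

Definition C1 f := (forall p, differentiable f p) /\
  forall i : 'I_2, continuous ('D_(delta_mx 0 i : plane R) f).

Lemma deriv_dot f p v : differentiable f p -> 'D_v f p = dot (grad f p) v.
Proof.
move=> df; rewrite /dot /grad.
under eq_bigr do rewrite mxE (deriveE _ df) mulrC.
rewrite (deriveE _ df) {1}(row_sum_delta v) linear_sum /=.
by apply: eq_bigr => i _; rewrite linearZ.
Qed.

Lemma is_derive_coordP (q : R -> plane R) (t : R) v :
  is_derive (t : R^o) 1 q v <->
  forall i, is_derive (t : R^o) (1 : R) (fun s => q s 0 i) (v 0 i).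
Proof.
split.
- move=> [dq <-] i; split; first by move/derivable_mxP: dq; apply.
  by rewrite derive_mx // mxE.
- move=> H.
  have dq : derivable (q : R^o -> _) t 1.
    by apply/derivable_mxP => i j; rewrite ord1; case: (H j).
  split=> //; rewrite derive_mx //; apply/rowP => j.
  by rewrite mxE; case: (H j).
Qed.

Lemma is_derive_line (p v : plane R) (s : R) :
  is_derive (s : R^o) 1 (fun s : R => p + s *: v) v.
Proof.
apply/is_derive_coordP => i.
rewrite (_ : (fun _ => _) = (fun s => p 0 i + s * v 0 i)); last first.
  by apply/funext => t; rewrite !mxE.
by apply: is_derive_eq; rewrite add0r scaler0 add0r mul1r [LHS]mulr1.
Qed.

Lemma derive_along_curve f (q : R -> plane R) (t : R) v : differentiable f (q t) ->
  is_derive (t : R^o) 1 q v -> is_derive (t : R^o) (1 : R) (f \o q) (dot (grad f (q t)) v).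
Proof.
move=> df [dq <-].
have dq' : differentiable (q : R^o -> _) t by exact/derivable1_diffP.
have dfq : differentiable (f \o q : R^o -> R^o) t by exact: differentiable_comp.
split; first exact/derivable1_diffP.
by rewrite deriveE // diff_comp //= -deriv_dot // !deriveE.
Qed.

(** The mean value theorem of one variable, applied to the restriction of [f]
    to the segment from [p] to [q]. *)
Lemma mvt_plane f p q : (forall x, differentiable f x) ->
  exists2 s, 0 <= s <= 1 & f q - f p = dot (grad f (p + s *: (q - p))) (q - p).
Proof.
move=> df.
have H s : is_derive (s : R^o) (1 : R) (f \o (fun s => p + s *: (q - p)))
    (dot (grad f (p + s *: (q - p))) (q - p)).
  by apply: derive_along_curve => //; apply: is_derive_line.
have [|s] := @MVT_segment R (f \o (fun s => p + s *: (q - p))) (fun s => dot (grad f (p + s *: (q - p))) (q - p)) 0 1 ler01.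
- apply: continuous_subspaceT => x; apply: differentiable_continuous.
  by apply/derivable1_diffP; case: (H x).
rewrite in_itv /= scale1r scale0r addr0 subr0 mulr1 [p + (q - p)]addrC subrK => s01 E.
by exists s.
Qed.

Lemma segment_near (p x y : plane R) (s r : R) : 0 <= s <= 1 ->
  `|x - p| < r -> `|y - p| < r -> `|x + s *: (y - x) - p| < r.
Proof.
move=> /andP[s0 s1] xr yr.
have -> : x + s *: (y - x) - p = (1 - s) *: (x - p) + s *: (y - p).
  by apply/plane_eq => i; rewrite !mxE; ring.
apply: le_lt_trans (ler_normD _ _) _; rewrite !normrZ ger0_norm ?subr_ge0//.
rewrite (ger0_norm s0).
case: (ltrP s 1) => [s1'|s1'].
  have : (1 - s) * `|x - p| < (1 - s) * r by rewrite ltr_pM2l ?subr_gt0.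
  have : s * `|y - p| <= s * r by rewrite ler_wpM2l // ltW.
  lra.
have -> : s = 1 by lra.
by rewrite subrr mul0r add0r mul1r.
Qed.

Lemma near_ball (P : set (plane R)) p : nbhs p P ->
  exists2 r : R, 0 < r & forall q, `|q - p| < r -> P q.
Proof.
move=> /nbhs_ballP[r r0 H]; exists r => // q qp; apply: H.
by rewrite mx_norm_ball /ball_ /= distrC.
Qed.

Lemma ball_near (P : set (plane R)) p (r : R) : 0 < r ->
  (forall q, `|q - p| < r -> P q) -> nbhs p P.
Proof.
move=> r0 H; apply/nbhs_ballP; exists r => // q.
by rewrite mx_norm_ball /ball_ /= distrC; apply: H.
Qed.

Lemma near_cont f p (e : R) : 0 < e -> {for p, continuous f} ->
  \forall q \near p, `|f q - f p| <= e.
Proof.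
by move=> e0 /cvgrPdist_le/(_ e e0); apply: filterS => q /=; rewrite distrC.
Qed.

Lemma C1_cont f : C1 f -> continuous f.
Proof. by move=> [df _] p; apply: differentiable_continuous. Qed.

Lemma grad_coord f p i : grad f p 0 i = 'D_(delta_mx 0 i : plane R) f p.
Proof. by rewrite mxE. Qed.

Lemma C1_grad_near f p (e : R) : C1 f -> 0 < e ->
  \forall q \near p, `|grad f q - grad f p| <= e.
Proof.
move=> [_ cf] e0.
have H i := near_cont e0 (cf i p).
near=> q; apply: norm_le; first exact: ltW.
apply: ord2_ind; rewrite !mxE; near: q; exact: H.
Unshelve. all: by end_near. Qed.

Lemma dot_le v w : `|dot v w| <= 2 * (`|v| * `|w|).
Proof.
rewrite dot2; apply: le_trans (ler_normD _ _) _; rewrite !normrM.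
have H i : `|v 0 i| * `|w 0 i| <= `|v| * `|w|.
  by apply: ler_pM => //; apply: coord_le_norm.
have := H 0; have := H 1; lra.
Qed.

Lemma det2_le v w : `|det2 v w| <= 2 * (`|v| * `|w|).
Proof.
rewrite /det2; apply: le_trans (ler_normB _ _) _; rewrite !normrM.
have H i j : `|v 0 i| * `|w 0 j| <= `|v| * `|w|.
  by apply: ler_pM => //; apply: coord_le_norm.
have := H 0 1; have := H 1 0; lra.
Qed.

End Plane.

(** * Primitives and mean value inequalities for curves *)
Section Picard.
Variable R : realType.
Implicit Types (v w p q : plane R).

(** Composition with [clamp a b] turns a function that is controlled only on
    [[a, b]] into one that is controlled on the whole line. *)
Definition clamp (a b t : R) : R := if t < a then a else if b < t then b else t.

Lemma clamp_in a b t : a <= b -> a <= clamp a b t <= b.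
Proof.
by rewrite /clamp; case: ltP => [_|h1]; [move=> ->; rewrite lexx|case: ltP => [_ ->|]];
  rewrite ?lexx ?h1.
Qed.

Lemma clamp_id a b t : a <= t <= b -> clamp a b t = t.
Proof. by rewrite /clamp => /andP[at_ tb]; rewrite !ltNge at_ tb. Qed.

Lemma clamp_lip a b s t : a <= b -> `|clamp a b s - clamp a b t| <= `|s - t|.
Proof.
move=> ab; rewrite /clamp.
have := ler_norm (s - t); have := ler_norm (t - s); rewrite (distrC t s) => H1 H2.
case: (ltP s a) => h1; last case: (ltP b s) => h2; (case: (ltP t a) => h3; last case: (ltP b t) => h4);
  rewrite ler_norml; apply/andP; split; have := normr_ge0 (s - t); lra.
Qed.

Lemma lip_continuous {V : normedModType R} (f : R -> V) (L : R) :
  (forall s t, `|f s - f t| <= L * `|s - t|) -> continuous f.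
Proof.
move=> H t; apply/cvgrPdist_le => e e0.
have L1 : 0 < `|L| + 1 by rewrite ltr_wpDl.
near=> s; apply: le_trans (H _ _) _.
have : `|t - s| <= e / (`|L| + 1).
  near: s; apply: cvgr_dist_le; last by rewrite divr_gt0.
  exact: cvg_id.
move=> h; apply: (@le_trans _ _ ((`|L| + 1) * `|t - s|)).
  by rewrite ler_wpM2r // (le_trans (ler_norm L)) // lerDl.
by rewrite mulrC -ler_pdivlMr.
Unshelve. all: by end_near. Qed.

Lemma clamp_continuous a b : a <= b -> continuous (clamp a b).
Proof.
move=> ab; apply: (@lip_continuous _ _ 1) => s t; rewrite mul1r; exact: clamp_lip.
Qed.

(** The integral from a base point left of the interval is differentiable at
    every interior point; clamping the upper bound makes it continuous
    everywhere, so that it can be fed again into an iteration. *)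
Lemma primitive (f : R -> R) : continuous f ->
  exists F : R -> R, [/\ continuous F, F 0 = 0 &
    forall t, `|t| < 1 -> is_derive (t : R^o) (1 : R) F (f t)].
Proof.
move=> cf.
set mu := @lebesgue_measure R.
have fint : mu.-integrable `[-2, 2] (EFin \o f).
  apply: continuous_compact_integrable; first exact: segment_compact.
  exact: continuous_subspaceT.
pose G x := (\int[mu]_(t in `[-2, x]) f t)%R.
have dG x : `|x| < 2 -> is_derive (x : R^o) (1 : R) G (f x).
  rewrite ltr_norml => /andP[x1 x2].
  have [dG GE] := continuous_FTC1_closed x2 fint x1 (cf x).
  apply: DeriveDef; first exact: dG.
  by rewrite -derive1E; exact: GE.
pose c := clamp (-1) 1.
have c01 t : -1 <= c t <= 1 by apply: clamp_in; lra.
exists (fun t => G (c t) - G (c 0)); split.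
- move=> t; apply: cvgB; last exact: cvg_cst.
  apply: continuous_comp; first by apply: clamp_continuous; lra.
  apply: differentiable_continuous; apply/derivable1_diffP.
  have := c01 t; rewrite -ler_norml => ct.
  by case: (dG (c t)) => //; rewrite (le_lt_trans ct) //; lra.
- by rewrite subrr.
- move=> t t1; apply: (@near_eq_is_derive _ _ _ (fun t => G t - G (c 0))).
    have := near_in_itvoo (a := -1) (b := 1 : R) (x := t).
    rewrite in_itv /= -ltr_norml => /(_ t1); apply: filterS => s.
    rewrite in_itv /= => /andP[s1 s2].
    by rewrite /c [clamp _ _ s]clamp_id // (ltW s1) (ltW s2).
  have := dG t; rewrite (lt_trans t1) ?ltr1n // => /(_ isT) D.
  by apply: is_derive_eq; rewrite subr0.
Qed.

Lemma primitive_plane (B : R -> plane R) w : continuous B ->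
  exists F : R -> plane R, [/\ continuous F, F 0 = w &
    forall t, `|t| < 1 -> is_derive (t : R^o) 1 F (B t)].
Proof.
move=> cB.
have cBi i : continuous (fun t => B t 0 i : R).
  move=> t; apply: (@continuous_comp _ _ _ B (fun M : plane R => M 0 i)).
    exact: cB.
  exact: coord_continuous.
have [F HF] := choice (fun i => primitive (cBi i)).
exists (fun t => w + \row_i F i t); split.
- move=> t; apply: cvgD; first exact: cvg_cst.
  apply/cvgrPdist_le => e e0.
  have H i : \forall s \near t, `|F i t - F i s| <= e.
    by have [c _ _] := HF i; have /cvgrPdist_le := c t; apply.
  near=> s; apply: norm_le; first exact: ltW.
  by apply: ord2_ind; rewrite !mxE; near: s; exact: H.
- by apply/rowP => i; rewrite !mxE; have [_ -> _] := HF i; rewrite addr0.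
- move=> t t1; apply/is_derive_coordP => i.
  have [_ _ /(_ t t1) D] := HF i.
  rewrite (_ : (fun _ => _) = (fun s => w 0 i + F i s)); last first.
    by apply/funext => s; rewrite !mxE.
  have := @is_deriveD _ _ _ (cst (w 0 i)) (F i) t 1 _ _ (is_derive_cst _ _ _) D.
  by rewrite add0r.
Unshelve. all: by end_near. Qed.

(** The norm is the maximum of the coordinates, so the scalar mean value theorem
    applied to each coordinate loses no constant. *)
Lemma mvt_curve (q v : R -> plane R) (a b c : R) : 0 <= c -> a <= b ->
  (forall s, a <= s <= b -> is_derive (s : R^o) 1 q (v s)) ->
  (forall s, a <= s <= b -> `|v s| <= c) -> `|q b - q a| <= c * (b - a).
Proof.
move=> c0 ab dq vc; apply: norm_le; first by rewrite mulr_ge0 // subr_ge0.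
move=> i.
have D s : a <= s <= b -> is_derive (s : R^o) (1 : R) (fun t => q t 0 i) (v s 0 i).
  by move=> sab; apply: (is_derive_coordP _ _ _).1 (dq s sab) i.
have D' s : s \in `]a, b[ -> is_derive (s : R^o) (1 : R) (fun t => q t 0 i) (v s 0 i).
  by rewrite in_itv /= => /andP[sa sb]; apply: D; rewrite !ltW.
have C : {within `[a, b], continuous (fun t => q t 0 i : R)}.
  apply: derivable_within_continuous => s; rewrite in_itv /= => sab.
  by have [] := D s sab.
have [s] := @MVT_segment R (fun t => q t 0 i) (fun s => v s 0 i) a b ab D' C.
rewrite in_itv /= !mxE => sab ->.
rewrite normrM (ger0_norm (x := b - a)) ?subr_ge0 // ler_wpM2r ?subr_ge0 //.
by apply: le_trans (coord_le_norm _ _) (vc s sab).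
Qed.

Lemma mvt_curve0 (q v : R -> plane R) (d c t : R) : 0 <= c -> `|t| <= d ->
  (forall s, `|s| <= d -> is_derive (s : R^o) 1 q (v s)) ->
  (forall s, `|s| <= d -> `|v s| <= c) -> `|q t - q 0| <= c * `|t|.
Proof.
move=> c0; rewrite ler_norml => /andP[td1 td2] dq vc.
case: (lerP 0 t) => t0.
  have -> : `|t| = t - 0 by rewrite subr0 ger0_norm.
  apply: (@mvt_curve q v 0 t c) => // s /andP[s0 st].
    by apply: dq; rewrite ler_norml; lra.
  by apply: vc; rewrite ler_norml; lra.
have -> : `|t| = 0 - t by rewrite sub0r ltr0_norm.
rewrite distrC; apply: (@mvt_curve q v t 0 c) => // [|s /andP[s0 st]|s /andP[s0 st]].
- exact: ltW.
- by apply: dq; rewrite ler_norml; lra.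
- by apply: vc; rewrite ler_norml; lra.
Qed.

End Picard.

(** * Local flows of C^1 vector fields *)
Section PicardFlow.
Variable R : realType.
Implicit Types (v w p q : plane R).

(** Picard iteration on [[-d, d]]. The smallness of [M * d] keeps the iterates
    in the ball where [A] is Lipschitz, and [K * d <= 1 / 2] makes consecutive
    iterates approach each other geometrically. The limit [phi] is only known
    to be Lipschitz; it is a solution because one more iteration step maps it
    to itself, and the image of a step is differentiable by construction. *)
Lemma picard (A : plane R -> plane R) p (r K M d : R) w :
  continuous A -> 0 < r -> 0 <= K -> 0 <= M -> 0 < d -> d < 1 ->
  (forall x y, `|x - p| <= r -> `|y - p| <= r -> `|A x - A y| <= K * `|x - y|) ->
  (forall x, `|x - p| <= r -> `|A x| <= M) ->
  M * d <= r / 2 -> K * d <= 1 / 2 -> `|w - p| <= r / 2 ->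
  exists phi : R -> plane R, phi 0 = w /\
    forall t, `|t| <= d -> `|phi t - p| <= r /\ is_derive (t : R^o) 1 phi (A (phi t)).
Proof.
move=> cA r0 K0 M0 d0 d1 lipA bndA Md Kd wp.
have /choice[S HS] : forall q : R -> plane R, exists F : R -> plane R,
    continuous q -> [/\ continuous F, F 0 = w &
      forall t, `|t| <= d -> is_derive (t : R^o) 1 F (A (q t))].
  move=> q; have [cq|ncq] := pselect (continuous q); last by exists q.
  have [|F [cF F0 dF]] := @primitive_plane R (fun t => A (q t)) w.
    by move=> t; apply: continuous_comp; [exact: cq|exact: cA].
  exists F => _; split=> // t td; apply: dF; exact: le_lt_trans td d1.
pose qn n := iter n S (cst w).
have cqn n : continuous (qn n).
  elim: n => [|n IH]; first by move=> t; exact: cvg_cst.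
  by have [] := HS _ IH.
have qnS n : [/\ qn n.+1 0 = w &
      forall t, `|t| <= d -> is_derive (t : R^o) 1 (qn n.+1) (A (qn n t))].
  by have [_ h1 h2] := HS _ (cqn n).
have d0' : `|0 : R| <= d by rewrite normr0 ltW.
have inb n t : `|t| <= d -> `|qn n t - p| <= r.
  elim: n t => [|n IH] t td; first by apply: le_trans wp _; lra.
  have [q0 dq] := qnS n.
  have := @mvt_curve0 R (qn n.+1) (fun t => A (qn n t)) d M t M0 td dq
    (fun s sd => bndA _ (IH s sd)).
  rewrite q0 => H; have -> : qn n.+1 t - p = (qn n.+1 t - w) + (w - p).
    by rewrite addrA subrK.
  apply: le_trans (ler_normD _ _) _.
  have : M * `|t| <= M * d by rewrite ler_wpM2l.
  lra.
have lipq n s t : `|s| <= d -> `|t| <= d -> `|qn n s - qn n t| <= M * `|s - t|.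
  wlog st : s t / s <= t.
    move=> H sd td; case: (leP s t) => st; first exact: H.
    by rewrite distrC (distrC s); apply: H => //; exact: ltW.
  move=> sd td; case: n => [|n]; first by rewrite subrr normr0 mulr_ge0.
  have [_ dq] := qnS n.
  rewrite distrC (distrC s) (ger0_norm (x := t - s)) ?subr_ge0//.
  have inn u : s <= u <= t -> `|u| <= d.
    by move: sd td; rewrite !ler_norml; lra.
  apply: (@mvt_curve _ _ (fun t => A (qn n t))) => // u /inn ud; first exact: dq.
  by apply: bndA; apply: inb.
have geo n t : `|t| <= d -> `|qn n.+1 t - qn n t| <= r / 2 ^+ n.
  elim: n t => [|n IH] t td.
    have [q0 dq] := qnS 0%N.
    have := @mvt_curve0 R (qn 1) (fun t => A (qn 0 t)) d M t M0 td dq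
      (fun s sd => bndA _ (inb 0%N s sd)).
    rewrite q0 expr0 divr1 => H; apply: le_trans H _.
    have : M * `|t| <= M * d by rewrite ler_wpM2l.
    lra.
  have [q0 dq] := qnS n; have [q0' dq'] := qnS n.+1.
  have D s : `|s| <= d -> is_derive (s : R^o) 1 (fun s => qn n.+2 s - qn n.+1 s)
      (A (qn n.+1 s) - A (qn n s)).
    by move=> sd; apply: is_deriveB; [exact: dq'|exact: dq].
  have P0 : 0 <= r / 2 ^+ n by rewrite divr_ge0 ?exprn_ge0 // ltW.
  have c0 : 0 <= K * (r / 2 ^+ n) by rewrite mulr_ge0.
  have := @mvt_curve0 R _ _ d (K * (r / 2 ^+ n)) t c0 td D.
  rewrite q0 q0' subrr subr0 => H; apply: le_trans (H _) _.
    move=> s sd; apply: le_trans (lipA _ _ (inb _ _ sd) (inb _ _ sd)) _.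
    by rewrite ler_wpM2l // IH.
  apply: (@le_trans _ _ (K * (r / 2 ^+ n) * d)); first by rewrite ler_wpM2l.
  rewrite mulrAC exprS invfM mulrCA mulrC.
  have : (K * d) * (r / 2 ^+ n) <= (1 / 2) * (r / 2 ^+ n) by rewrite ler_wpM2r.
  lra.
have tail n m t : `|t| <= d -> `|qn (n + m)%N t - qn n t| <= 2 * r / 2 ^+ n.
  move=> td.
  have : `|qn (n + m)%N t - qn n t| <= 2 * r / 2 ^+ n - 2 * r / 2 ^+ (n + m).
    elim: m => [|m IH]; first by rewrite addn0 !subrr normr0.
    rewrite addnS.
    have := ler_distD (qn (n + m)%N t) (qn (n + m).+1 t) (qn n t).
    have := geo (n + m)%N t td.
    have -> : 2 * r / 2 ^+ (n + m).+1 = r / 2 ^+ (n + m).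
      by rewrite exprS invfM mulrACA divff ?pnatr_eq0 // mul1r.
    move: IH; rewrite -[2 * r / 2 ^+ (n + m)]mulrA; lra.
  move=> H; apply: le_trans H _; rewrite gerBl divr_ge0 ?exprn_ge0 ?mulr_ge0 //.
  exact: ltW.
have small (e : R) : 0 < e -> exists n, 2 * r / 2 ^+ n <= e.
  move=> e0.
  have H : (2 * r) *: (2^-1 ^+ n : R^o) @[n --> \oo] --> ((2 * r) *: (0 : R^o)).
    apply: cvgZr; apply: cvg_expr; rewrite ger0_norm; lra.
  rewrite scaler0 in H.
  have [N _ HN] := (cvgrPdist_le _ _).1 H e e0.
  exists N; have := HN N (leqnn N); rewrite /= sub0r normrN => H1.
  by apply: le_trans H1; rewrite -exprVn; exact: ler_norm.
have lim t : exists l, `|t| <= d -> forall n, `|l - qn n t| <= 2 * r / 2 ^+ n.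
  have [td|] := pselect (`|t| <= d); last by exists 0.
  have cau : cauchy (qn n t @[n --> \oo]).
    apply: cauchy_exP => e e0.
    have [N HN] := small (e / 2) (divr_gt0 e0 (ltr0n _ 2)).
    exists (qn N t); exists N => // m /= Nm.
    rewrite mx_norm_ball /ball_ /= distrC -(subnKC Nm).
    apply: le_lt_trans (tail _ _ _ td) _; apply: le_lt_trans HN _; lra.
  have /cauchy_cvgP /cvg_ex[l Hl] := cau.
  exists l => _ n; apply/ler_addgt0Pr => e e0.
  have [N _ HN] := (cvgrPdist_le _ _).1 Hl e e0.
  have := HN (n + N)%N (leq_addl _ _); rewrite /= => H1.
  have := ler_distD (qn (n + N)%N t) l (qn n t); have := tail n N t td; lra.
have [phi Hphi] := choice lim.
have lipphi s t : `|s| <= d -> `|t| <= d -> `|phi s - phi t| <= M * `|s - t|.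
  move=> sd td; apply/ler_addgt0Pr => e e0.
  have [N HN] := small (e / 2) (divr_gt0 e0 (ltr0n _ 2)).
  have H1 := Hphi s sd N; have H2 := Hphi t td N; have H3 := lipq N s t sd td.
  have H4 := ler_distD (qn N s) (phi s) (phi t).
  have H5 := ler_distD (qn N t) (qn N s) (phi t).
  rewrite (distrC (phi t)) in H2; lra.
(* The iteration step acts on functions defined on the whole line. *)
pose c := clamp (- d) d.
have dd : - d <= d by lra.
have cd t : `|c t| <= d by rewrite ler_norml; exact: clamp_in.
have cid t : `|t| <= d -> c t = t by rewrite ler_norml => /clamp_id.
have cphi : continuous (phi \o c).
  apply: (@lip_continuous _ _ _ M) => s t /=.
  apply: le_trans (lipphi _ _ (cd s) (cd t)) _; rewrite ler_wpM2l //.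
  exact: clamp_lip.
have [_ F0 dF] := HS _ cphi.
have inphi t : `|t| <= d -> `|phi t - p| <= r.
  move=> td; apply/ler_addgt0Pr => e e0; have [N HN] := small e e0.
  have H1 := Hphi t td N; have H2 := inb N t td.
  have := ler_distD (qn N t) (phi t) p; lra.
have E t : `|t| <= d -> S (phi \o c) t = phi t.
  move=> td; apply/eqP; rewrite -subr_eq0 -normr_le0; apply/ler_addgt0Pr => e e0.
  have [N HN] := small (e / 2) (divr_gt0 e0 (ltr0n _ 2)).
  have [q0 dq] := qnS N.
  have D s : `|s| <= d -> is_derive (s : R^o) 1 (fun s => S (phi \o c) s - qn N.+1 s)
      (A (phi (c s)) - A (qn N s)).
    by move=> sd; apply: is_deriveB; [exact: dF|exact: dq].
  have c0 : 0 <= K * (2 * r / 2 ^+ N).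
    by rewrite mulr_ge0 // divr_ge0 ?exprn_ge0 ?mulr_ge0 // ltW.
  have := @mvt_curve0 R _ _ d _ t c0 td D.
  rewrite F0 q0 subrr subr0 => H.
  have {}H : `|S (phi \o c) t - qn N.+1 t| <= K * (2 * r / 2 ^+ N) * `|t|.
    apply: H => s sd; rewrite (cid s sd).
    apply: le_trans (lipA _ _ (inphi s sd) (inb _ _ sd)) _.
    by rewrite ler_wpM2l // Hphi.
  have H1 := Hphi t td N.+1.
  have H2 := ler_distD (qn N.+1 t) (S (phi \o c) t) (phi t).
  rewrite (distrC (phi t)) in H1.
  have H3 : 2 * r / 2 ^+ N.+1 <= e / 2.
    apply: le_trans HN; rewrite exprS invfM ler_pM2l ?mulr_gt0 //.
    have : 0 < (2 ^+ N : R)^-1 by rewrite invr_gt0 exprn_gt0.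
    lra.
  have H4 : K * (2 * r / 2 ^+ N) * `|t| <= (K * d) * (2 * r / 2 ^+ N).
    rewrite mulrAC ler_wpM2r //; last by rewrite ler_wpM2l.
    by rewrite divr_ge0 ?exprn_ge0 ?mulr_ge0 // ltW.
  have H5 : (K * d) * (2 * r / 2 ^+ N) <= (1 / 2) * (2 * r / 2 ^+ N).
    rewrite ler_wpM2r // divr_ge0 ?exprn_ge0 ?mulr_ge0 //; exact: ltW.
  lra.
exists (S (phi \o c)); split=> // t td; rewrite E //; split; first exact: inphi.
by have := dF t td; rewrite /= cid.
Qed.

Definition C1field (A : plane R -> plane R) := forall i : 'I_2, C1 (fun p => A p 0 i).

Lemma C1field_cont A : C1field A -> continuous A.
Proof.
move=> CA p; apply/(@cvgrPdist_le _ _ _ (nbhs p)) => e e0.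
have H i := near_cont e0 (C1_cont (CA i) (x := p)).
near=> s; apply: norm_le; first exact: ltW.
apply: ord2_ind; rewrite !mxE distrC; near: s; exact: H.
Unshelve. all: by end_near. Qed.

Lemma field_near (A : plane R -> plane R) p (e : R) : continuous A -> 0 < e ->
  \forall q \near p, `|A q - A p| <= e.
Proof.
move=> cA e0; have H : A q @[q --> nbhs p] --> A p := cA p.
have H1 : \forall q \near p, `|A p - A q| <= e.
  exact: (cvgrPdist_le (F := nbhs p) A (A p)).1 H _ e0.
near=> q; rewrite distrC; near: q; exact: H1.
Unshelve. all: by end_near.
Qed.

(** A C^1 field is bounded and Lipschitz near [p] by the mean value theorem, so
    Picard iteration applies with a time and a radius that are uniform in the
    starting point. *)
Lemma local_flow A p (U : set (plane R)) : C1field A -> nbhs p U ->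
  exists rho d : R, [/\ 0 < rho, 0 < d & forall w, `|w - p| < rho ->
    exists phi : R -> plane R, phi 0 = w /\
      forall t, `|t| <= d -> U (phi t) /\ is_derive (t : R^o) 1 phi (A (phi t))].
Proof.
move=> CA NU; have cA := C1field_cont CA.
have HG i := C1_grad_near p (CA i) ltr01.
have [r1 r10 Hr1] := near_ball (filterI NU (filterI (field_near p cA ltr01)
  (filterI (HG 0) (HG 1)))).
have {}HG q i : `|q - p| < r1 ->
    `|grad (fun x => A x 0 i) q - grad (fun x => A x 0 i) p| <= 1.
  by move: i; elim/ord2_ind => /Hr1 [_ [_ []]].
pose r := r1 / 2; have r0 : 0 < r by rewrite divr_gt0.
have rr1 x : `|x - p| <= r -> `|x - p| < r1.
  by move=> h; apply: le_lt_trans h _; rewrite /r; lra.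
pose M := `|A p| + 1.
pose K := 2 * (`|grad (fun x => A x 0 0) p| + `|grad (fun x => A x 0 1) p| + 1).
have M0 : 0 < M by rewrite ltr_wpDl.
have K0 : 0 < K by rewrite mulr_gt0 // ltr_wpDl // addr_ge0.
have bndA x : `|x - p| <= r -> `|A x| <= M.
  move=> /rr1 /Hr1 [_ [H _]]; have -> : A x = (A x - A p) + A p by rewrite subrK.
  by apply: le_trans (ler_normD _ _) _; rewrite /M addrC lerD2l.
have lipA x y : `|x - p| <= r -> `|y - p| <= r -> `|A x - A y| <= K * `|x - y|.
  move=> /rr1 xr /rr1 yr; apply: norm_le; first by rewrite mulr_ge0 // ltW.
  move=> i; have [s s01] := mvt_plane y x (CA i).1.
  rewrite !mxE => ->; apply: le_trans (dot_le _ _) _.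
  rewrite mulrA ler_wpM2r // ler_pM2l //.
  have H := HG _ i (segment_near s01 yr xr).
  have := ler_normD (grad (fun x => A x 0 i) (y + s *: (x - y)) - grad (fun x => A x 0 i) p)
    (grad (fun x => A x 0 i) p); rewrite subrK => H1.
  have H2 : `|grad (fun x => A x 0 i) p| <= `|grad (fun x => A x 0 0) p| + `|grad (fun x => A x 0 1) p|.
    by move: i {H H1}; apply: ord2_ind; rewrite ?lerDl ?lerDr.
  by rewrite (le_trans H1) // addrC lerD.
pose d := Num.min (1 / 2) (Num.min (r / 2 / M) (1 / 2 / K)).
have d0 : 0 < d by rewrite !lt_min !divr_gt0.
exists (r / 2), d; split => //; first by rewrite divr_gt0.
move=> w wp.
have [||||phi [phi0 Hphi]] := @picard A p r K M d w cA r0 (ltW K0) (ltW M0) d0 _ lipA bndA.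
- by rewrite (@le_lt_trans _ _ (1 / 2)) // ?ge_min ?lexx //; lra.
- by rewrite mulrC -ler_pdivlMr // !ge_min lexx orbT.
- by rewrite mulrC -ler_pdivlMr // !ge_min lexx !orbT.
- exact: ltW.
exists phi; split=> // t td; have [h1 h2] := Hphi t td; split=> //.
by have [] := Hr1 _ (rr1 _ h1).
Qed.

End PicardFlow.

(** * Steering by finite pieces of switched trajectories *)
Section Steer.
Variable R : realType.
Implicit Types (X Y : plane R -> plane R) (p z w : plane R) (U : set (plane R)).

Definition lip_on (a b : R) (q : R -> plane R) : Prop := exists L : R,
  forall s t, a <= s <= b -> a <= t <= b -> `|q s - q t| <= L * `|s - t|.

Lemma lip_on_ext a b (q q' : R -> plane R) :
  (forall t, a <= t <= b -> q' t = q t) -> lip_on a b q -> lip_on a b q'.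
Proof. by move=> E [L HL]; exists L => s t hs ht; rewrite !E //; exact: HL. Qed.

Lemma lip_on_shift a b c (q : R -> plane R) :
  lip_on a b q -> lip_on (a + c) (b + c) (fun t => q (t - c)).
Proof.
move=> [L HL]; exists L => s t hs ht.
have -> : s - t = (s - c) - (t - c) by ring.
by apply: HL; rewrite lerBrDr lerBlDr.
Qed.

Lemma lip_on_glue a b c (q : R -> plane R) :
  lip_on a b q -> lip_on b c q -> lip_on a c q.
Proof.
move=> [L1 H1] [L2 H2]; pose L := `|L1| + `|L2|.
have LL1 (s : R) : L1 * `|s| <= L * `|s|.
  by rewrite ler_wpM2r // (le_trans (ler_norm _)) // lerDl.
have LL2 (s : R) : L2 * `|s| <= L * `|s|.
  by rewrite ler_wpM2r // (le_trans (ler_norm _)) // lerDr.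
exists L => s t.
wlog st : s t / s <= t.
  move=> H hs ht; case: (leP s t) => st; first exact: H.
  by rewrite distrC (distrC s); apply: H => //; exact: ltW.
move=> /andP[sa sc] /andP[ta tc]; case: (leP t b) => tb.
  by apply: le_trans _ (LL1 _); apply: H1; rewrite ?sa ?ta ?tb ?(le_trans st tb).
case: (leP b s) => sb.
  by apply: le_trans _ (LL2 _); apply: H2; rewrite ?sb ?sc ?tc ?(le_trans sb st).
have h1 : `|q s - q b| <= L * `|s - b|.
  by apply: le_trans _ (LL1 _); apply: H1; rewrite ?sa ?(ltW sb) ?lexx ?(le_trans sa (ltW sb)).
have h2 : `|q b - q t| <= L * `|b - t|.
  by apply: le_trans _ (LL2 _); apply: H2; rewrite ?(ltW tb) ?tc ?lexx ?(le_trans (ltW tb) tc).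
apply: le_trans (ler_distD (q b) _ _) _; apply: le_trans (lerD h1 h2) _.
rewrite -mulrDr (ler0_norm (x := s - b)) ?(ler0_norm (x := b - t))
  ?(ler0_norm (x := s - t)) ?subr_le0 ?(ltW sb) ?(ltW tb) //.
by have -> : - (s - b) + - (b - t) = - (s - t) by ring.
Qed.

(** The derivative is only asked for off a countable set, which is stable under
    infinite concatenation, and the curve is Lipschitz so that pieces glue into
    an absolutely continuous curve. *)
Definition steers_by X Y U (u : R -> R) (tau : R) (q : R -> plane R) : Prop :=
  [/\ measurable_fun setT u, forall t, 0 <= u t <= 1,
      forall t, 0 <= t <= tau -> U (q t),
      lip_on 0 tau q &
      exists2 D : set R, countable D & forall t, 0 < t < tau -> ~ D t ->
        is_derive (t : R^o) 1 q (u t *: X (q t) + (1 - u t) *: Y (q t))].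

(** Reachability inside [U] by a piece of positive duration: a chain of
    infinitely many such pieces then has strictly increasing switching times. *)
Definition steer X Y U z w : Prop :=
  exists (tau : R) (u : R -> R) (q : R -> plane R),
    [/\ 0 < tau, q 0 = z, q tau = w & steers_by X Y U u tau q].

Lemma steer_sub X Y U V z w : U `<=` V -> steer X Y U z w -> steer X Y V z w.
Proof.
move=> UV [tau [u [q [t0 qz qw [mu u01 Uq lq dq]]]]].
exists tau, u, q; split=> //; split=> // t /Uq; exact: UV.
Qed.

Lemma steer_swap X Y U z w : steer X Y U z w -> steer Y X U z w.
Proof.
move=> [tau [u [q [t0 qz qw [mu u01 Uq lq [D cD dq]]]]]].
exists tau, (fun t => 1 - u t), q; split=> //; split=> //.
- by apply: measurable_realfun.measurable_funB => //; exact: measurable_cst.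
- by move=> t; have := u01 t; lra.
- exists D => // t t0' Dt; have := dq t t0' Dt.
  by rewrite addrC subKr.
Qed.

Lemma is_derive_shiftr (q : R -> plane R) (a t : R) v :
  is_derive ((t - a) : R^o) 1 q v -> is_derive (t : R^o) 1 (fun t => q (t - a)) v.
Proof.
move=> /is_derive_coordP dq; apply/is_derive_coordP => i.
have D1 : is_derive (t : R^o) (1 : R) (fun t : R => t - a) 1.
  by apply: is_derive_eq; rewrite oppr0 addr0.
have := @is_derive1_comp R (fun s => q s 0 i) (fun t => t - a) t _ _ (dq i) D1.
by rewrite mulr1.
Qed.

Lemma near_itv (a b t : R) : a < t < b -> \forall s \near t, a < s < b.
Proof.
move=> tab; have := @near_in_itvoo _ a b t; rewrite in_itv /= => /(_ tab).
by apply: filterS => s; rewrite in_itv.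
Qed.

Lemma near_lt (a b : R) : a < b -> \forall s \near a, s < b.
Proof.
move=> ab; have := @near_itv (a - 1) b a; rewrite ab ltrBlDr ltrDl ltr01.
by move=> /(_ isT); apply: filterS => s /andP[].
Qed.

Lemma near_gt (a b : R) : b < a -> \forall s \near a, b < s.
Proof.
move=> ab; have := @near_itv b (a + 1) a; rewrite ab ltrDl ltr01.
by move=> /(_ isT); apply: filterS => s /andP[].
Qed.

Lemma countable_setU (A B : set R) : countable A -> countable B -> countable (A `|` B).
Proof.
move=> cA cB; rewrite -bigcup2E; apply: bigcup_countable => // -[|[|i]] _ //=.
Qed.

Lemma steer_trans X Y U z1 z2 z3 :
  steer X Y U z1 z2 -> steer X Y U z2 z3 -> steer X Y U z1 z3.
Proof.
move=> [t1 [u1 [q1 [t10 q1z q1w [mu1 u101 Uq1 lq1 [D1 cD1 dq1]]]]]].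
move=> [t2 [u2 [q2 [t20 q2z q2w [mu2 u201 Uq2 lq2 [D2 cD2 dq2]]]]]].
pose u t := if t < t1 then u1 t else u2 (t - t1).
pose q t := if t < t1 then q1 t else q2 (t - t1).
have qlt t : t <= t1 -> q t = q1 t.
  rewrite /q; case: ltP => // h1 h2; have -> : t = t1 by lra.
  by rewrite subrr q2z q1w.
have qge t : t1 <= t -> q t = q2 (t - t1) by rewrite /q; case: ltP => //; lra.
exists (t1 + t2), u, q; split.
- by rewrite addr_gt0.
- by rewrite qlt // ltW.
- by rewrite qge ?lerDl ?ltW // addrC addKr.
split.
- apply: measurable_fun_ifT => //.
  + exact: measurable_realfun.measurable_fun_ltr.
  + apply: measurableT_comp => //.
    apply: measurable_realfun.measurable_funB => //; exact: measurable_cst.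
- by move=> t; rewrite /u; case: ifP.
- move=> t t12; case: (leP t t1) => h; first by rewrite qlt //; apply: Uq1; lra.
  rewrite qge ?ltW //; apply: Uq2; lra.
- apply: (@lip_on_glue _ t1).
    by apply: lip_on_ext lq1 => t /andP[_ tt1]; exact: qlt.
  have := lip_on_shift t1 lq2; rewrite add0r addrC.
  by apply: lip_on_ext => t /andP[tt1 _]; exact: qge.
- exists (D1 `|` (fun s => s + t1) @` D2 `|` [set t1]).
    by do 2?[apply: countable_setU] => //; exact: sub_countable (card_image_le _ _) cD2.
  move=> t tt nD.
  have tn1 : t <> t1 by move=> e; apply: nD; right.
  case: (ltP t t1) => h.
    rewrite qlt ?(ltW h) // /u h.
    apply: (@near_eq_is_derive _ _ _ q1).
      by apply: filterS (near_lt h) => s sh; rewrite qlt // ltW.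
    by apply: dq1; [lra|move=> D; apply: nD; left; left].
  have {tn1} h' : t1 < t by rewrite lt_neqAle h andbT eq_sym; apply/eqP.
  rewrite qge // /u ltNge h /=.
  apply: (@near_eq_is_derive _ _ _ (fun t => q2 (t - t1))).
    by apply: filterS (near_gt h') => s sh; rewrite qge // ltW.
  apply: is_derive_shiftr; apply: dq2; first by lra.
  by move=> D; apply: nD; left; right; exists (t - t1); rewrite ?subrK.
Qed.

Lemma steer_flow X Y U (phi : R -> plane R) (a b M : R) : a < b ->
  (forall t, a <= t <= b -> U (phi t) /\ is_derive (t : R^o) 1 phi (X (phi t))) ->
  (forall x, U x -> `|X x| <= M) ->
  steer X Y U (phi a) (phi b).
Proof.
move=> ab H HM.
exists (b - a), (cst 1), (fun t => phi (t + a)); split.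
- by rewrite subr_gt0.
- by rewrite add0r.
- by rewrite subrK.
have M0 : 0 <= M.
  by have [Ua _] := H a ltac:(lra); apply: le_trans (HM _ Ua).
split.
- exact: measurable_cst.
- by move=> t; rewrite /=; lra.
- by move=> t tt; have [] := H (t + a) ltac:(lra).
- exists M => s t; wlog st : s t / s <= t.
    move=> HH hs ht; case: (leP s t) => st; first exact: HH.
    by rewrite distrC (distrC s); apply: HH => //; exact: ltW.
  move=> hs ht; rewrite distrC (distrC s) (ger0_norm (x := t - s)) ?subr_ge0 //.
  have -> : t - s = (t + a) - (s + a) by ring.
  apply: (@mvt_curve _ _ (fun t => X (phi t))) => //; first by lra.
    by move=> r rr; have [] := H r ltac:(lra).
  by move=> r rr; have [Ur _] := H r ltac:(lra); apply: HM.
- exists set0; first exact: countable0.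
  move=> t tt _; rewrite /= scale1r subrr scale0r addr0.
  have [_ D] := H (t + a) ltac:(lra).
  have := @is_derive_shiftr phi (- a) t (X (phi (t + a))).
  by rewrite opprK; apply.
Qed.

(** Where the two fields are opposite, a suitable convex combination of them
    vanishes, so one can stay at rest for any duration. *)
Lemma steer_refl X Y U z (k : R) : U z -> 0 < k -> Y z = - k *: X z ->
  steer X Y U z z.
Proof.
move=> Uz k0 E.
have k1 : 0 < 1 + k by lra.
exists 1, (cst (k / (1 + k))), (cst z); split => //; split=> //.
- move=> t /=; apply/andP; split; first by rewrite divr_ge0 // ltW.
  by rewrite ler_pdivrMr // mul1r; lra.
- by exists 0 => s t _ _; rewrite subrr normr0 mul0r.
- exists set0; first exact: countable0.
  move=> t _ _; rewrite /= E scalerA -scalerDl.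
  have -> : k / (1 + k) + (1 - k / (1 + k)) * - k = 0 by field; rewrite gt_eqF.
  by rewrite scale0r; exact: is_derive_cst.
Qed.

End Steer.

(** * Steering along a segment *)
Section TimeChange.
Variable R : realType.
Implicit Types (X Y : plane R -> plane R) (p z w d : plane R) (U : set (plane R)).

Lemma det2_continuous (A B : R -> plane R) : continuous A -> continuous B ->
  continuous (fun s => det2 (A s) (B s)).
Proof.
move=> cA cB s.
have cc (C : R -> plane R) i : continuous C -> {for s, continuous (fun s => C s 0 i : R)}.
  move=> cC; apply: (@continuous_comp _ _ _ C (fun M : plane R => M 0 i)).
    exact: cC.
  exact: coord_continuous.
by apply: cvgB; apply: cvgM; apply: cc.
Qed.

(** [sigma] is the inverse of a primitive of [g]. The minimum of [g] on the
    interval is positive, and its inverse is a Lipschitz constant of [sigma].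
    Since primitives are controlled on [(-1, 1)] only, the range [[0, l]] has
    to be shorter than one. *)
Lemma time_reparametrisation (g : R -> R) (l : R) : continuous g -> 0 < l < 1 -> (forall s, 0 < g s) ->
  exists tau (sigma : R -> R), [/\ 0 < tau, sigma 0 = 0, sigma tau = l,
    (forall t, 0 <= t <= tau -> 0 <= sigma t <= l) /\
    (exists L, forall s t, 0 <= s <= tau -> 0 <= t <= tau ->
      `|sigma s - sigma t| <= L * `|s - t|) &
    forall t, 0 < t < tau -> is_derive (t : R^o) (1 : R) sigma (g (sigma t))^-1].
Proof.
move=> cg /andP[l0 l1] g0.
have [F [cF F0 dF]] := primitive cg.
have [c _ Hc] := EVT_min (ltW l0) (continuous_subspaceT cg (A := `[0, l])).
have m0 := g0 c; set m := g c in Hc m0.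
have incr s t : 0 <= s -> s <= t -> t <= l -> m * (t - s) <= F t - F s.
  move=> s0 st tl.
  have D x : x \in `]s, t[ -> is_derive (x : R^o) (1 : R) F (g x).
    rewrite in_itv /= => /andP[sx xt]; apply: dF; rewrite ltr_norml; lra.
  have [x xst ->] := MVT_segment st D (continuous_subspaceT cF (A := `[s, t])).
  rewrite ler_wpM2r ?subr_ge0 //; apply: Hc.
  by move: xst; rewrite !in_itv /=; lra.
have lt_F s t : 0 <= s -> s < t -> t <= l -> F s < F t.
  move=> s0 st tl; have := incr s t s0 (ltW st) tl.
  have : 0 < m * (t - s) by rewrite mulr_gt0 // subr_gt0.
  lra.
have inj s t : 0 <= s <= l -> 0 <= t <= l -> F s = F t -> s = t.
  move=> /andP[s0 sl] /andP[t0 tl] E.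
  have [h|h|//] := ltgtP s t.
    by have := lt_F _ _ s0 h tl; rewrite E ltxx.
  by have := lt_F _ _ t0 h sl; rewrite E ltxx.
have tau0 : 0 < F l by rewrite -F0; apply: lt_F.
have /choice[sigma Hs] : forall t, exists s, 0 <= t <= F l -> 0 <= s <= l /\ F s = t.
  move=> t; have [tt|] := pselect (0 <= t <= F l); last by exists 0.
  have [||s] := @IVT R F 0 l t (ltW l0).
  - exact: continuous_subspaceT.
  - by rewrite F0 min_l ?max_r // ltW.
  - by rewrite in_itv /= => sl Fs; exists s.
have sF s : 0 <= s <= l -> sigma (F s) = s.
  move=> sl; have /andP[s0 sl'] := sl.
  have [|h1 h2] := Hs (F s); last exact: inj.
  have := incr 0 s (lexx _) s0 sl'; have := incr s l s0 sl' (lexx _); rewrite F0.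
  have : 0 <= m * (s - 0) by apply: mulr_ge0; [exact: ltW|rewrite subr_ge0].
  have : 0 <= m * (l - s) by apply: mulr_ge0; [exact: ltW|rewrite subr_ge0].
  lra.
have Ftau : 0 <= F l <= F l by lra.
exists (F l), sigma; split => //.
- by rewrite -{1}F0 sF // lexx ltW.
- by rewrite sF // lexx ltW.
- split; first by move=> t /Hs [].
  exists m^-1 => s t.
  wlog st : s t / sigma s <= sigma t.
    move=> H hs ht; case: (leP (sigma s) (sigma t)) => st; first exact: H.
    by rewrite distrC (distrC s); apply: H => //; exact: ltW.
  move=> hs ht; have [/andP[s0 sl] Es] := Hs s hs; have [/andP[t0 tl] Et] := Hs t ht.
  have := incr _ _ s0 st tl; rewrite Es Et => H.
  rewrite distrC (distrC s) (ger0_norm (x := sigma t - _)) ?subr_ge0 //.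
  rewrite mulrC ler_pdivlMr // mulrC; apply: le_trans H _; exact: ler_norm.
- move=> t tt; have [|sl Es] := Hs t; first by lra.
  have sl' : 0 < sigma t < l.
    rewrite !lt_neqAle; have /andP[-> ->] := sl; rewrite !andbT; apply/andP; split.
      by apply/eqP => E; move: Es; rewrite -E F0; lra.
    by apply/eqP => E; move: Es; rewrite E; lra.
  rewrite -[X in is_derive X _ _ _]Es; apply: is_derive_inverse.
  + have N := near_itv sl'; near=> s; apply: sF.
    have /andP[h1 h2] : 0 < s < l by near: s; exact: N.
    by rewrite !ltW.
  + by near=> s; exact: cF.
  + by apply: dF; rewrite ltr_norml; lra.
  + by rewrite gt_eqF.
Unshelve. all: by end_near. Qed.

(** The two positivity conditions say that [d] lies in the open cone spanned by
    [X] and [Y] at each point of the segment: by Cramer's rule [d = a X + b Y]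
    where [a] and [b] are these two quotients. Running along the segment with
    speed [1 / (a + b)] gives a trajectory with control [a / (a + b)]. *)
Lemma steer_segment X Y U w d : continuous X -> continuous Y ->
  (forall s, 0 <= s <= 1 -> let x := w + s *: d in
    [/\ U x, 0 < det2 d (Y x) / det2 (X x) (Y x) & 0 < det2 (X x) d / det2 (X x) (Y x)]) ->
  steer X Y U w (w + d).
Proof.
move=> cX cY H.
(* The segment is run through while s goes from 0 to 1/2, hence the factor 2. *)
pose c (s : R) := w + (2 * clamp 0 (1 / 2) s) *: d.
have h2 : (0 : R) <= 1 / 2 by lra.
have cin (s : R) : 0 <= 2 * clamp 0 (1 / 2) s <= 1.
  by have := clamp_in s h2; lra.
have cc : continuous c.
  move=> s; apply: cvgD; first exact: cvg_cst.
  apply: cvgZl; apply: cvgM; first exact: cvg_cst.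
  exact: clamp_continuous.
have cXc : continuous (X \o c) by move=> s; apply: continuous_comp; [exact: cc|exact: cX].
have cYc : continuous (Y \o c) by move=> s; apply: continuous_comp; [exact: cc|exact: cY].
have cd : continuous (cst d : R -> plane R) by move=> s; exact: cvg_cst.
pose a s := det2 d (Y (c s)) / det2 (X (c s)) (Y (c s)).
pose b s := det2 (X (c s)) d / det2 (X (c s)) (Y (c s)).
have a0 s : 0 < a s by have [_ h _] := H _ (cin s).
have b0 s : 0 < b s by have [_ _ h] := H _ (cin s).
have D0 s : det2 (X (c s)) (Y (c s)) != 0.
  by apply/eqP => E; have := a0 s; rewrite /a E invr0 mulr0 ltxx.
have ca : continuous a.
  move=> s; apply: cvgM; first exact: (det2_continuous cd cYc).
  by apply: cvgV => //; exact: (det2_continuous cXc cYc).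
have cb : continuous b.
  move=> s; apply: cvgM; first exact: (det2_continuous cXc cd).
  by apply: cvgV => //; exact: (det2_continuous cXc cYc).
pose g s := 2 * (a s + b s).
have cg : continuous g.
  by move=> s; apply: cvgM; [exact: cvg_cst|apply: cvgD; [exact: ca|exact: cb]].
have g0 s : 0 < g s by rewrite mulr_gt0 // addr_gt0.
have l01 : 0 < (1 / 2 : R) < 1 by lra.
have [tau [sg [tau0 sg0 sgt [sgin [L HL]] dsg]]] := time_reparametrisation cg l01 g0.
have gE (s : R) : 0 <= s <= 1 / 2 -> c s = w + (2 * s) *: d by move=> /clamp_id; rewrite /c => ->.
pose f t := a (sg t) / (a (sg t) + b (sg t)).
have ab s : 0 < a s + b s by rewrite addr_gt0.
exists tau, (f \_ `]0, tau[), (fun t => w + (2 * sg t) *: d); split => //.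
- by rewrite sg0 mulr0 scale0r addr0.
- by rewrite sgt mulrC divfK ?scale1r // gt_eqF.
split.
- apply/(measurable_restrictT _ _).1 => //.
  apply: measurable_realfun.open_continuous_measurable_fun; first exact: interval_open.
  move=> t; rewrite inE /= in_itv /= => tt.
  have csg : {for t, continuous sg}.
    by apply: differentiable_continuous; apply/derivable1_diffP; case: (dsg t tt).
  have cas : {for t, continuous (a \o sg)} by apply: continuous_comp => //; exact: ca.
  have cbs : {for t, continuous (b \o sg)} by apply: continuous_comp => //; exact: cb.
  apply: cvgM => //; apply: cvgV; first by rewrite gt_eqF.
  exact: cvgD.
- move=> t; rewrite patchE; case: ifP => _; last by rewrite lexx ler01.
  apply/andP; split; first by rewrite divr_ge0 // ltW.
  by rewrite ler_pdivrMr // mul1r lerDl ltW.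
- by move=> t /sgin st; have [] := H (2 * sg t) ltac:(lra).
- exists (2 * L * `|d|) => s t hs ht.
  have -> : w + (2 * sg s) *: d - (w + (2 * sg t) *: d) = (2 * (sg s - sg t)) *: d.
    by apply/plane_eq => i; rewrite !mxE; ring.
  rewrite normrZ normrM (ger0_norm (x := 2)) //.
  have -> : 2 * L * `|d| * `|s - t| = 2 * (L * `|s - t|) * `|d| by ring.
  by rewrite ler_wpM2r // ler_pM2l // HL.
- exists set0; first exact: countable0.
  move=> t tt _.
  rewrite patchE mem_set /=; last by rewrite in_itv.
  have sin : 0 <= sg t <= 1 / 2 by apply: sgin; lra.
  have E := gE _ sin; rewrite -E /f.
  have D := dsg t tt.
  apply/is_derive_coordP => i.
  rewrite (_ : (fun _ => _) = (fun s => w 0 i + 2 * d 0 i * sg s)); last first.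
    by apply/funext => s; rewrite !mxE; ring.
  have D1 : is_derive (t : R^o) (1 : R) (fun s => w 0 i + (2 * d 0 i) *: sg s)
      (0 + (2 * d 0 i) *: (g (sg t))^-1).
    by apply: is_deriveD.
  apply: is_derive_eq D1 _.
  rewrite add0r /g !mxE; have Dn := D0 (sg t); have abn := ab (sg t).
  have -> : d 0 i = a (sg t) * X (c (sg t)) 0 i + b (sg t) * Y (c (sg t)) 0 i.
    by move: i; apply: ord2_ind; rewrite /a /b; move: Dn; rewrite /det2 => Dn; field.
  by rewrite /GRing.scale /=; field; rewrite gt_eqF.
Qed.

End TimeChange.

(** * Points where the fields cross the collinearity locus *)
Section Transversal.
Variable R : realType.
Implicit Types (A B X Y : plane R -> plane R) (p z w d v : plane R) (U : set (plane R))
  (f P : plane R -> R).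

Lemma eq_ler (x y : R) : x = y -> x <= y.
Proof. by move=> ->. Qed.

Lemma dotDl v w d : dot (v + w) d = dot v d + dot w d.
Proof. by rewrite !dot2 !mxE; ring. Qed.

Lemma dotDr v w d : dot d (v + w) = dot d v + dot d w.
Proof. by rewrite !dot2 !mxE; ring. Qed.

Lemma dotZr (s : R) v w : dot v (s *: w) = s * dot v w.
Proof. by rewrite !dot2 !mxE; ring. Qed.

Lemma det2Dl v w d : det2 (v + w) d = det2 v d + det2 w d.
Proof. by rewrite /det2 !mxE; ring. Qed.

Lemma det2Dr v w d : det2 d (v + w) = det2 d v + det2 d w.
Proof. by rewrite /det2 !mxE; ring. Qed.

Lemma det2Zl (s : R) v w : det2 (s *: v) w = s * det2 v w.
Proof. by rewrite /det2 !mxE; ring. Qed.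

Lemma det2C v w : det2 v w = - det2 w v.
Proof. by rewrite /det2; ring. Qed.

(** Splits off the error made by replacing the gradient [g] at a nearby point
    by the gradient [n] at the base point. *)
Lemma dot_split (s : R) (g n v w : plane R) :
  dot g (s *: v + w) = s * dot n v + dot n w + dot (g - n) (s *: v + w).
Proof. by rewrite !dot2 !mxE; ring. Qed.

Lemma dot_bound v w (x y : R) : `|v| <= x -> `|w| <= y -> `|dot v w| <= 2 * (x * y).
Proof.
move=> vx wy; apply: le_trans (dot_le _ _) _; rewrite ler_pM2l //.
by apply: ler_pM.
Qed.

Lemma det2_bound v w (x y : R) : `|v| <= x -> `|w| <= y -> `|det2 v w| <= 2 * (x * y).
Proof.
move=> vx wy; apply: le_trans (det2_le _ _) _; rewrite ler_pM2l //.
by apply: ler_pM.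
Qed.

(** By the mean value theorem a secant of a level set is orthogonal to the
    gradient at some nearby point. *)
Lemma secant_almost_tangent f p (eta : R) : C1 f -> 0 < eta -> exists2 r : R, 0 < r &
  forall z1 z2, `|z1 - p| < r -> `|z2 - p| < r -> f z1 = f z2 ->
    `|dot (grad f p) (z2 - z1)| <= 2 * (eta * `|z2 - z1|).
Proof.
move=> Cf eta0; have [r r0 Hr] := near_ball (C1_grad_near p Cf eta0).
exists r => // z1 z2 h1 h2 E.
have [s s01] := mvt_plane z1 z2 Cf.1; rewrite E subrr => /esym E1.
have -> : dot (grad f p) (z2 - z1) =
    - dot (grad f (z1 + s *: (z2 - z1)) - grad f p) (z2 - z1).
  by rewrite dotDl E1 add0r !dot2 !mxE; ring.
rewrite normrN; apply: dot_bound => //; apply: Hr; exact: segment_near.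
Qed.

(** The linear forms [dot (grad f p)] and [det2 v] are independent when [v] is
    not tangent to the level set of [f]; secants of a level set almost annihilate
    the first one, so the second one controls their length. *)
Lemma secant_det_lower_bound f p v : C1 f -> dot (grad f p) v != 0 ->
  exists r c : R, [/\ 0 < r, 0 < c & forall z1 z2, `|z1 - p| < r -> `|z2 - p| < r ->
    f z1 = f z2 -> c * `|z2 - z1| <= `|det2 v (z2 - z1)|].
Proof.
move=> Cf a0; set al := `|dot (grad f p) v|.
have al0 : 0 < al by rewrite normr_gt0.
set S := `|v| + 1; have S0 : 0 < S by rewrite ltr_wpDl.
set N := `|grad f p| + 1; have N0 : 0 < N by rewrite ltr_wpDl.
have [|r r0 Hr] := @secant_almost_tangent f p (al / (4 * S)) Cf.
  by rewrite divr_gt0 // mulr_gt0.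
exists r, (al / (2 * N)); split => //; first by rewrite divr_gt0 // mulr_gt0.
move=> z1 z2 h1 h2 E; have {Hr} := Hr z1 z2 h1 h2 E.
set d := z2 - z1; set t := dot _ d => Ht.
have key i : al * `|d 0 i| <= al / 2 * `|d| + `|det2 v d| * N.
  have vS j : `|v 0 j| <= S by apply: le_trans (coord_le_norm v j) _; rewrite /S lerDl.
  have nN j : `|grad f p 0 j| <= N.
    by apply: le_trans (coord_le_norm _ j) _; rewrite /N lerDl.
  have tb j : `|t * v 0 j| <= al / 2 * `|d|.
    rewrite normrM; apply: le_trans (_ : 2 * (al / (4 * S) * `|d|) * S <= _).
      by apply: ler_pM.
    by apply: eq_ler; field; rewrite gt_eqF.
  have db j : `|det2 v d * grad f p 0 j| <= `|det2 v d| * N.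
    by rewrite normrM ler_wpM2l.
  rewrite -normrM; move: i; apply: ord2_ind.
    have -> : dot (grad f p) v * d 0 0 = t * v 0 0 - det2 v d * grad f p 0 1.
      by rewrite /t !dot2 /det2; ring.
    by apply: le_trans (ler_normB _ _) _; apply: lerD.
  have -> : dot (grad f p) v * d 0 1 = t * v 0 1 + det2 v d * grad f p 0 0.
    by rewrite /t !dot2 /det2; ring.
  by apply: le_trans (ler_normD _ _) _; apply: lerD.
have : `|d| <= (al / 2 * `|d| + `|det2 v d| * N) / al.
  apply: norm_le; last by move=> i; rewrite ler_pdivlMr // mulrC.
  by rewrite divr_ge0 ?addr_ge0 ?mulr_ge0 ?divr_ge0 // ltW.
rewrite ler_pdivlMr // => H.
have H1 : `|d| * al <= 2 * (`|det2 v d| * N) by lra.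
have -> : al / (2 * N) * `|d| = (`|d| * al) / (2 * N) by field; rewrite gt_eqF.
by rewrite ler_pdivrMr ?mulr_gt0 // mulrCA.
Qed.

Lemma sgn_div_gt0 (e x y : R) : e * e = 1 -> 0 < e * x -> 0 < e * y -> 0 < x / y.
Proof.
move=> ee ex ey; have -> : x / y = (e * x) / (e * y).
  have e0 : e != 0 by apply/eqP => E; move: ee; rewrite E mul0r => /eqP; rewrite eq_sym oner_eq0.
  have y0 : y != 0 by apply/eqP => E; move: ey; rewrite E mulr0 ltxx.
  by field; rewrite ?e0 ?y0.
by rewrite divr_gt0.
Qed.

Lemma curve_drift (q v : R -> plane R) w (a b c : R) : 0 <= c -> a <= b ->
  (forall t, a <= t <= b -> is_derive (t : R^o) 1 q (v t)) ->
  (forall t, a <= t <= b -> `|v t - w| <= c) ->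
  `|q b - q a - (b - a) *: w| <= c * (b - a).
Proof.
move=> c0 ab dq vw.
have := @mvt_curve R (fun t => q t - t *: w) (fun t => v t - w) a b c c0 ab.
have -> : q b - b *: w - (q a - a *: w) = q b - q a - (b - a) *: w.
  by apply/plane_eq => i; rewrite !mxE; ring.
apply => // t tt; apply: is_deriveB; first exact: dq.
have := @is_derive_line R 0 w t.
by rewrite (_ : (fun s => 0 + s *: w) = (fun s => s *: w)) //; apply/funext => x; rewrite add0r.
Qed.

(** Near [p] the fields [A] and [B] are almost opposite and [A] enters the side
    [P > 0] of the locus, so [B] leaves it. On that side the cone spanned by
    the fields is close to the open half plane on which [e * det2 (A p)] is
    positive, and the secant [d = z2 - z1] lies in it. A trajectory from [z1] to
    [z2] is made of three parts: follow [A] from [z1] for the time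
    [s = `|d|], then a segment, then follow [B] for the time [s / k] so as
    to arrive at [z2]. Since [B p = - k *: A p], both ends of the segment are
    displaced by [s *: A p] up to a small error, so the segment is a small
    perturbation of [d], and it stays at a height of order [s] above the
    locus, while [P] varies along it by a small multiple of [s] only. *)
Lemma transversal_steer_oneside A B P p U (k e : R) :
  C1field A -> C1field B -> C1 P -> 0 < k -> e * e = 1 -> B p = - k *: A p ->
  (forall q, P q = e * det2 (A q) (B q)) -> 0 < dot (grad P p) (A p) -> nbhs p U ->
  exists2 r : R, 0 < r & forall z1 z2, `|z1 - p| < r -> `|z2 - p| < r ->
    P z1 = 0 -> P z2 = 0 -> 0 < e * det2 (A p) (z2 - z1) -> steer A B U z1 z2.
Proof.
move=> CA CB CP k0 ee BA PE al0 NU.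
have cA := C1field_cont CA; have cB := C1field_cont CB.
have [r0 [c [r00 c0 Hsec]]] := secant_det_lower_bound CP (lt0r_neq0 al0).
set al := dot _ _ in al0; set N := `|grad P p|; set S := `|A p|.
pose ka := 1 + k^-1.
have k'0 : 0 < k^-1 by rewrite invr_gt0.
have ka0 : 0 < ka by rewrite addr_gt0.
have N0 : 0 <= N := normr_ge0 _.
have S0 : 0 <= S := normr_ge0 _.
(* eta bounds the oscillation of A, B and grad P near p, relative to their
   values at p. K1, K2 and K3 collect the resulting errors in P along the
   segment and in the two coefficients of the cone condition. *)
pose K1 := 2 * N + 2 * (S + 1) + 2 + 2 * (N * ka) + 2 * (1 + ka).
pose K2 := 2 * (S * ka) + 2 * (1 + ka).
pose K3 := k * (2 * (S * ka)) + 2 * (1 + ka).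
have Nka : 0 <= N * ka by rewrite mulr_ge0 // ltW.
have Ska : 0 <= S * ka by rewrite mulr_ge0 // ltW.
have kSka : 0 <= k * (2 * (S * ka)) by apply: mulr_ge0; [exact: ltW|exact: mulr_ge0].
have K10 : 0 < K1 by rewrite /K1; lra.
have K20 : 0 < K2 by rewrite /K2; lra.
have K30 : 0 < K3 by rewrite /K3; lra.
have kc0 : 0 < k * c by rewrite mulr_gt0.
pose eta := Num.min (Num.min 1 (al / (2 * K1)))
  (Num.min (c / (2 * K2)) (k * c / (2 * K3))).
have eta0 : 0 < eta by rewrite !lt_min ltr01 !divr_gt0 // mulr_gt0.
have eta1 : eta <= 1 by rewrite !ge_min lexx.
have etaK (K x : R) : 0 < K -> 0 < x -> eta <= x / (2 * K) -> eta * K < x.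
  move=> HK Hx; rewrite ler_pdivlMr ?mulr_gt0 // => h.
  by clear -h Hx HK eta0; lra.
have e1 : eta * K1 < al by apply: etaK => //; rewrite !ge_min lexx !orbT.
have e2 : eta * K2 < c by apply: etaK => //; rewrite !ge_min lexx !orbT.
have e3 : eta * K3 < k * c by apply: etaK => //; rewrite !ge_min lexx !orbT.
clearbody eta.
have [r1 r10 Hr1] := near_ball (filterI NU (filterI (field_near p cA eta0)
  (filterI (field_near p cB eta0) (C1_grad_near p CP eta0)))).
pose V := [set q | `|q - p| < r1].
have NV : nbhs p V by apply: (ball_near r10).
have [rA [dA [rA0 dA0 HA]]] := local_flow CA NV.
have [rB [dB [rB0 dB0 HB]]] := local_flow CB NV.
have [r2 r20 Hr2] := secant_almost_tangent p CP eta0.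
have [r [rr0 ra rb [rc rd re rf rg]]] : exists r, [/\ 0 < r, r <= r0, r <= r1 &
    [/\ r <= rA, r <= rB, r <= r2, 2 * r <= dA & 2 * r <= dB * k]].
  exists (Num.min (Num.min (Num.min r0 r1) (Num.min rA rB))
    (Num.min r2 (Num.min (dA / 2) (dB * k / 2)))).
  split; last split; rewrite ?(mulrC 2) -?ler_pdivlMr //;
    do ?by rewrite !ge_min lexx ?orbT.
  by rewrite !lt_min r00 r10 rA0 rB0 r20 !divr_gt0 // mulr_gt0.
exists r => // z1 z2 h1 h2 P1 P2 Hd.
have E12 : P z1 = P z2 by rewrite P1 P2.
have := Hr2 z1 z2 (lt_le_trans h1 re) (lt_le_trans h2 re) E12.
have := Hsec z1 z2 (lt_le_trans h1 ra) (lt_le_trans h2 ra) E12.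
have d2r : `|z2 - z1| < 2 * r.
  have -> : z2 - z1 = (z2 - p) - (z1 - p) by rewrite opprB addrA subrK.
  by apply: le_lt_trans (ler_normB _ _) _; clear -h1 h2; lra.
have [phi [phi0 Hphi]] := HA z1 (lt_le_trans h1 rc).
have [psi [psi0 Hpsi]] := HB z2 (lt_le_trans h2 rd).
have d0 : 0 < `|z2 - z1|.
  rewrite normr_gt0; apply/eqP => E; move: Hd; by rewrite E /det2 !mxE !mulr0 subrr mulr0 ltxx.
move: Hd d2r d0; set d := z2 - z1; set s := `|d| => Hd d2r s0 Hc Hn.
have ebound x : `|e * x| = `|x|.
  rewrite normrM.
  have -> : `|e| = 1; last by rewrite mul1r.
  by apply/eqP; rewrite -(@eqrXn2 _ 2) // ?real_normK ?num_real // expr1n expr2 ee.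
rewrite -ebound gtr0_norm // in Hc.
have sk0 : 0 < s / k by rewrite divr_gt0.
have phi_in t : 0 <= t <= s -> `|t| <= dA by move=> /andP[t0 ts]; rewrite ger0_norm //; clear -ts d2r rf; lra.
have skB : s / k <= dB by rewrite ler_pdivrMr //; clear -d2r rg; lra.
have psi_in t : - (s / k) <= t <= 0 -> `|t| <= dB.
  by move=> /andP[t0 ts]; rewrite ler0_norm //; clear -skB t0; lra.
pose w := phi s; pose w' := psi (- (s / k)).
(* Deviation of the two flow arcs from straight motion along s *: A p. *)
pose E1 := w - z1 - s *: A p; pose E2 := w' - z2 - s *: A p.
have Vw : V w by have [] := Hphi s (phi_in s _); rewrite ?lexx ?ltW.
have Vw' : V w' by have [] := Hpsi (- (s / k)) (psi_in _ _); rewrite ?lexx ?oppr_le0 ?ltW.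
have HE1 : `|E1| <= eta * s.
  have := @curve_drift phi (fun t => A (phi t)) (A p) 0 s eta (ltW eta0) (ltW s0).
  rewrite phi0 !subr0; apply=> t /phi_in tt; have [Vt D] := Hphi t tt => //.
  by have [_ []] := Hr1 _ Vt.
have HE2 : `|E2| <= eta * (s / k).
  have sk0' : - (s / k) <= 0 by rewrite oppr_le0 ltW.
  have := @curve_drift psi (fun t => B (psi t)) (B p) (- (s / k)) 0 eta (ltW eta0) sk0'.
  rewrite psi0 sub0r opprK.
  have -> : z2 - psi (- (s / k)) - (s / k) *: B p = - E2.
    rewrite /E2 /w' BA; apply/plane_eq => i; rewrite !mxE; field; rewrite gt_eqF //.
  rewrite normrN; apply=> t /psi_in tt; have [Vt D] := Hpsi t tt => //.
  by have [_ [_ []]] := Hr1 _ Vt.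
pose E := E2 - E1.
have HE : `|E| <= eta * (ka * s).
  apply: le_trans (ler_normB _ _) _; apply: le_trans (lerD HE2 HE1) _.
  by apply: eq_ler; rewrite /ka; ring.
have d'E : w' - w = d + E.
  by rewrite /E /E1 /E2 /d; apply/plane_eq => i; rewrite !mxE; ring.
have kas : 0 <= ka * s by rewrite mulr_ge0 // ltW.
have Hd' : `|w' - w| <= (1 + ka) * s.
  rewrite d'E; apply: le_trans (ler_normD _ _) _.
  have H : eta * (ka * s) <= 1 * (ka * s) by rewrite ler_wpM2r.
  rewrite -/s; clear -HE H; lra.
have es0 : 0 <= eta * s by rewrite mulr_ge0 // ltW.
(* The first flow arc has climbed to a height of about s * al. *)
have Pw : s * al - 2 * (N * (eta * s)) - 2 * (eta * s * (S + 1)) <= P w.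
  have Vz1 : V z1 by exact: lt_le_trans h1 rb.
  have [x x01] := mvt_plane z1 w CP.1; rewrite P1 subr0 => ->.
  have [_ [_ [_ Hg]]] := Hr1 _ (segment_near x01 Vz1 Vw).
  set g := grad P _ in Hg *.
  have -> : dot g (w - z1) = s * al + dot (grad P p) E1 + dot (g - grad P p) (w - z1).
    rewrite -[w - z1](subrKC (s *: A p)) -/E1; exact: dot_split.
  have B1 := dot_bound (lexx N) HE1.
  have wz : `|w - z1| <= s * (S + 1).
    have -> : w - z1 = s *: A p + E1 by rewrite /E1 subrKC.
    apply: le_trans (ler_normD _ _) _; rewrite normrZ (gtr0_norm s0).
    have H : eta * s <= 1 * s by rewrite ler_wpM2r // ltW.
    rewrite -/S; clear -H HE1; lra.
  have B2 := dot_bound Hg wz; rewrite !ler_norml in B1 B2; clear -B1 B2; lra.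
have ndet : c * s - 2 * (S * (eta * (ka * s))) <= e * det2 (A p) (w' - w).
  rewrite d'E det2Dr mulrDr.
  have B1 : `|e * det2 (A p) E| <= 2 * (S * (eta * (ka * s))).
    by rewrite ebound; apply: det2_bound.
  rewrite ler_norml in B1; clear -Hc B1; lra.
have seg : steer A B V w w'.
  rewrite -[w'](subrKC w).
  apply: steer_segment => // t t01 x.
  have Vx : V x by apply: segment_near.
  have [_ [HAx [HBx _]]] := Hr1 _ Vx.
  have Px : 0 < P x.
    have [y y01] := mvt_plane w x CP.1.
    have Vy : V (w + y *: (x - w)) by apply: segment_near.
    have [_ [_ [_ Hg]]] := Hr1 _ Vy.
    set g := grad P _ in Hg *.
    have -> : x - w = t *: (w' - w) by rewrite /x addrC addKr.
    rewrite dotZr => Exw.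
    have H1 : `|dot g (w' - w)| <= 2 * (eta * s) + 2 * (N * (eta * (ka * s))) + 2 * (eta * ((1 + ka) * s)).
      have -> : dot g (w' - w) = dot (grad P p) d + dot (grad P p) E + dot (g - grad P p) (w' - w).
        by rewrite -dotDr -d'E -dotDl subrKC.
      apply: le_trans (ler_normD _ _) _; apply: lerD; last exact: dot_bound.
      by apply: le_trans (ler_normD _ _) _; apply: lerD => //; exact: dot_bound.
    have H2 : `|t * dot g (w' - w)| <= `|dot g (w' - w)|.
      by have /andP[t0 t1] := t01; rewrite normrM ler_piMl // ger0_norm.
    have H3 := le_trans H2 H1; rewrite ler_norml in H3.
    (* The height of w exceeds the variation of P along the segment. *)
    have H4 : 0 < s * (al - eta * K1) by rewrite mulr_gt0 // subr_gt0.
    rewrite /K1 in H4; clear -H4 H3 Pw Exw; lra.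
  have eP : 0 < e * det2 (A x) (B x) by rewrite -PE.
  have D1 : 0 < e * det2 (A x) (w' - w).
    rewrite -[A x](subrKC (A p)).
    rewrite det2Dl mulrDr.
    have B1 := det2_bound HAx Hd'; rewrite -ebound ler_norml in B1.
    have H4 : 0 < s * (c - eta * K2) by rewrite mulr_gt0 // subr_gt0.
    rewrite /K2 in H4; clear -H4 B1 ndet; lra.
  have D2 : 0 < e * det2 (w' - w) (B x).
    have -> : B x = - k *: A p + (B x - B p) by rewrite -BA subrKC.
    rewrite det2C det2Dl det2Zl.
    have B1 := det2_bound HBx Hd'; rewrite -ebound ler_norml in B1.
    have H4 : 0 < s * (k * c - eta * K3) by rewrite mulr_gt0 // subr_gt0.
    have H5 := ler_wpM2l (ltW k0) ndet.
    rewrite /K3 in H4; clear -H4 H5 B1; lra.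
  split=> //; exact: sgn_div_gt0 ee _ _.
have UV : V `<=` U by move=> q /Hr1 [].
apply: (steer_sub UV).
have bA x : V x -> `|A x| <= S + 1.
  move=> /Hr1 [_ [H _]]; rewrite -[A x](subrKC (A p)).
  by apply: le_trans (ler_normD _ _) _; rewrite lerD2l (le_trans H).
have bB x : V x -> `|B x| <= `|B p| + 1.
  move=> /Hr1 [_ [_ [H _]]]; rewrite -[B x](subrKC (B p)).
  by apply: le_trans (ler_normD _ _) _; rewrite lerD2l (le_trans H).
have S1 : steer A B V z1 w.
  rewrite -phi0; apply: (@steer_flow _ A B V phi 0 s (S + 1)) => // t /phi_in tt; exact: Hphi.
have S2 : steer A B V w' z2.
  rewrite -psi0; apply: steer_swap.
  apply: (@steer_flow _ B A V psi (- (s / k)) 0 (`|B p| + 1)) => //; first by rewrite oppr_lt0.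
  by move=> t /psi_in tt; exact: Hpsi.
exact: steer_trans S1 (steer_trans seg S2).
Qed.

End Transversal.

(** * The locus as a graph, and orbits that cross it twice *)
Section Graph.
Variable R : realType.
Implicit Types (A B X Y : plane R -> plane R) (p z w d v : plane R) (U : set (plane R))
  (f P : plane R -> R).

Lemma ord2_cases (i j k : 'I_2) : i != j -> k = i \/ k = j.
Proof.
by move: i; elim/ord2_ind; move: j; elim/ord2_ind; move: k; elim/ord2_ind => //; auto.
Qed.

Lemma dot_ij (i j : 'I_2) v w : i != j -> dot v w = v 0 i * w 0 i + v 0 j * w 0 j.
Proof.
by move: i; elim/ord2_ind; move: j; elim/ord2_ind => // _; rewrite dot2 // addrC.
Qed.

Definition axis_point (i : 'I_2) (x y : R) : plane R := \row_k (if k == i then x else y).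

(** The implicit function theorem for one equation: on each line in direction
    [j] the function is strictly increasing and changes sign, and two zeros
    satisfy a Lipschitz estimate because the secant between them is orthogonal
    to some nearby gradient. The parameter of [gam] is the offset of the
    coordinate [i]. *)
Lemma zero_graph_pos f p U (i j : 'I_2) : C1 f -> f p = 0 -> i != j ->
  0 < grad f p 0 j -> nbhs p U ->
  exists (del r L : R) (gam : R -> plane R), [/\ 0 < del, 0 < r,
    gam 0 = p /\ (forall x, `|x| < del -> [/\ U (gam x), f (gam x) = 0 & gam x = p -> x = 0]),
    forall x y, `|x| < del -> `|y| < del -> `|gam x - gam y| <= L * `|x - y| &
    forall z, `|z - p| < r -> f z = 0 -> exists2 x, `|x| < del & z = gam x].
Proof.
move=> Cf fp ij D0 NU; set D := grad f p 0 j in D0.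
pose m := D / 2; have m0 : 0 < m by rewrite divr_gt0.
have [r1 r10 Hr] := near_ball (filterI NU (C1_grad_near p Cf m0)).
pose M := `|grad f p| + m.
have M0 : 0 < M by rewrite ltr_wpDl.
have gj q : `|q - p| < r1 -> m <= grad f q 0 j.
  move=> /Hr [_ H]; have := le_trans (coord_le_norm _ j) H.
  rewrite !mxE -!grad_coord -/D ler_norml /m; clear; lra.
have gi q : `|q - p| < r1 -> `|grad f q 0 i| <= M.
  move=> /Hr [_ H]; apply: le_trans (coord_le_norm _ i) _.
  rewrite -[grad f q](subrKC (grad f p)).
  by apply: le_trans (ler_normD _ _) _; rewrite lerD2l.
have mvt q1 q2 : `|q1 - p| < r1 -> `|q2 - p| < r1 -> exists2 g : plane R,
    m <= g 0 j /\ `|g 0 i| <= M &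
    f q2 - f q1 = g 0 i * (q2 0 i - q1 0 i) + g 0 j * (q2 0 j - q1 0 j).
  move=> h1 h2; have [s s01 E] := mvt_plane q1 q2 Cf.1.
  exists (grad f (q1 + s *: (q2 - q1))).
    by split; [apply: gj|apply: gi]; apply: segment_near.
  by rewrite E (dot_ij _ _ ij) !mxE.
have lip z1 z2 : `|z1 - p| < r1 -> `|z2 - p| < r1 -> f z1 = 0 -> f z2 = 0 ->
    `|z1 0 j - z2 0 j| <= M / m * `|z1 0 i - z2 0 i|.
  move=> h1 h2 E1 E2; have [g [g1 g2]] := mvt z2 z1 h2 h1.
  rewrite E1 E2 subrr => /esym/eqP; rewrite addr_eq0 => /eqP E.
  rewrite mulrAC ler_pdivlMr //.
  apply: le_trans (_ : g 0 j * `|z1 0 j - z2 0 j| <= _).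
    by rewrite mulrC ler_wpM2r.
  have gj0 : 0 < g 0 j := lt_le_trans m0 g1.
  rewrite -[g 0 j]gtr0_norm // -normrM -normrN -E normrM.
  by rewrite ler_wpM2r.
pose b := r1 / 2; have b0 : 0 < b by rewrite divr_gt0.
have br : b < r1 by rewrite /b; clear -r10; lra.
pose del := Num.min b (m * b / (2 * M)).
have del0 : 0 < del by rewrite lt_min b0 divr_gt0 // mulr_gt0.
have delb : del <= b by rewrite ge_min lexx.
have delM : del * (2 * M) <= m * b.
  by rewrite -ler_pdivlMr ?mulr_gt0 // ge_min lexx orbT.
pose q (x y : R) := axis_point i (p 0 i + x) (p 0 j + y).
have qi x y : q x y 0 i = p 0 i + x by rewrite mxE eqxx.
have qj x y : q x y 0 j = p 0 j + y by rewrite mxE eq_sym (negbTE ij).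
have qin x y : `|x| < r1 -> `|y| < r1 -> `|q x y - p| < r1.
  move=> h1 h2; apply: norm_lt => // k; have [->|->] := ord2_cases k ij; rewrite !mxE.
    by rewrite eqxx addrC addKr.
  by rewrite eq_sym (negbTE ij) addrC addKr.
have pin : `|p - p| < r1 by rewrite subrr normr0.
have fq x y : `|x| < del -> `|y| <= b -> exists2 g : plane R,
    m <= g 0 j /\ `|g 0 i * x| <= m * b / 2 & f (q x y) = g 0 i * x + g 0 j * y.
  move=> hx hy; have [|g [g1 g2]] := mvt p (q x y) pin.
    by apply: qin; [exact: lt_trans (lt_le_trans hx delb) br|exact: le_lt_trans hy br].
  rewrite fp subr0 qi qj (addrC (p 0 i)) (addrC (p 0 j)) !addrK => E.
  exists g => //; split=> //; rewrite normrM.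
  apply: le_trans (_ : M * del <= _); first by apply: ler_pM => //; exact: ltW.
  clear -delM; lra.
have cq x : continuous (q x).
  apply: (@lip_continuous _ _ _ 1) => s t; rewrite mul1r.
  apply: norm_le => // k; have [->|->] := ord2_cases k ij; rewrite !mxE.
    by rewrite eqxx subrr normr0.
  rewrite eq_sym (negbTE ij).
  by have -> : p 0 j + s - (p 0 j + t) = s - t by ring.
have /choice[psi Hpsi] : forall x, exists y, `|x| < del -> `|y| <= b /\ f (q x y) = 0.
  move=> x; have [xd|] := pselect (`|x| < del); last by exists 0.
  have [g1 [g11 g12] E1] := fq x b xd ltac:(by rewrite gtr0_norm).
  have [g2 [g21 g22] E2] := fq x (- b) xd ltac:(by rewrite normrN gtr0_norm).
  have mb : 0 < m * b by rewrite mulr_gt0.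
  have h1 : 0 < f (q x b).
    rewrite E1; have := ler_wpM2r (ltW b0) g11; move: g12; rewrite ler_norml.
    clear -mb; lra.
  have h2 : f (q x (- b)) < 0.
    rewrite E2; have := ler_wpM2r (ltW b0) g21; move: g22; rewrite ler_norml.
    clear -mb; lra.
  have bb : - b <= b by clear -b0; lra.
  have [||y] := @IVT R (f \o q x) (- b) b 0 bb.
  - apply: continuous_subspaceT => y; apply: continuous_comp; first exact: cq.
    exact: C1_cont Cf _.
  - rewrite /= minElt maxElt (lt_trans h2 h1) (ltW h1) (ltW h2) //.
  - rewrite in_itv /= => yb E; exists y => _; split => //; by rewrite ler_norml.
pose gam x := q x (psi x).
have gin x : `|x| < del -> `|gam x - p| < r1.
  move=> xd; have [h _] := Hpsi x xd; apply: qin; last exact: le_lt_trans h br.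
  exact: lt_trans (lt_le_trans xd delb) br.
have gz x : `|x| < del -> f (gam x) = 0 by move=> xd; have [_] := Hpsi x xd.
have uniq z1 z2 : `|z1 - p| < r1 -> `|z2 - p| < r1 -> f z1 = 0 -> f z2 = 0 ->
    z1 0 i = z2 0 i -> z1 = z2.
  move=> h1 h2 E1 E2 E; have := lip z1 z2 h1 h2 E1 E2.
  rewrite E subrr normr0 mulr0 normr_le0 subr_eq0 => /eqP E'.
  by apply: plane_eq => k; have [->|->] := ord2_cases k ij.
have d00 : `|0 : R| < del by rewrite normr0.
exists del, del, (M / m + 1), gam; split => //.
- split; first by apply: uniq => //; [exact: gin|exact: gz|rewrite qi addr0].
  move=> x xd; split; [|exact: gz|].
    by have [] := Hr _ (gin x xd).
  move=> E; have := qi x (psi x); rewrite -/(gam x) E => /esym/eqP.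
  by rewrite -subr_eq0 addrC addKr => /eqP.
- move=> x y xd yd; have Mm : 0 <= M / m by rewrite divr_ge0 // ltW.
  have E : gam x 0 i - gam y 0 i = x - y by rewrite !qi; ring.
  apply: norm_le; first by rewrite mulr_ge0 // addr_ge0.
  move=> k; have [->|->] := ord2_cases k ij; rewrite [X in `|X|]mxE [X in _ + X]mxE.
    by rewrite E ler_peMl // lerDr.
  apply: le_trans (lip _ _ (gin x xd) (gin y yd) (gz x xd) (gz y yd)) _.
  by rewrite E ler_wpM2r // lerDl.
- move=> z zp Ez; pose x := z 0 i - p 0 i.
  have xd : `|x| < del.
    apply: le_lt_trans zp; have := coord_le_norm (z - p) i; by rewrite !mxE.
  exists x => //; apply: uniq => //.
  + exact: lt_trans (lt_le_trans zp delb) br.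
  + exact: gin.
  + exact: gz.
  + by rewrite qi /x addrC subrK.
Qed.

Lemma deriv_scale f (e : R) p v : differentiable f p ->
  'D_v (fun q => e * f q) p = e * 'D_v f p.
Proof.
move=> df; have dv : derivable f p v by exact: diff_derivable.
exact: (deriveZ e dv).
Qed.

Lemma gradZ f (e : R) p : differentiable f p ->
  grad (fun q => e * f q) p = e *: grad f p.
Proof. by move=> df; apply/plane_eq => i; rewrite !mxE deriv_scale. Qed.

Lemma C1Z f (e : R) : C1 f -> C1 (fun q => e * f q).
Proof.
move=> [df cf]; split.
  by move=> p; apply: differentiableM.
move=> i p; rewrite (_ : 'D_(delta_mx 0 i) (fun q => e * f q) =
    (fun p => e * 'D_(delta_mx 0 i : plane R) f p)); last first.
  by apply/funext => q; exact: deriv_scale.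
have H := cf i p.
by apply: (@cvgM _ _ (nbhs p) _ (cst e)); [exact: cvg_cst|exact: H].
Qed.

Lemma zero_graph f p U : C1 f -> f p = 0 -> grad f p != 0 -> nbhs p U ->
  exists (del r L : R) (gam : R -> plane R), [/\ 0 < del, 0 < r,
    gam 0 = p /\ (forall x, `|x| < del -> [/\ U (gam x), f (gam x) = 0 & gam x = p -> x = 0]),
    forall x y, `|x| < del -> `|y| < del -> `|gam x - gam y| <= L * `|x - y| &
    forall z, `|z - p| < r -> f z = 0 -> exists2 x, `|x| < del & z = gam x].
Proof.
move=> Cf fp g0 NU.
have [j gj] : exists j, grad f p 0 j != 0.
  by apply/not_existsP => H; move/eqP: g0; apply; apply/plane_eq => i;
     rewrite [RHS]mxE; apply/eqP/negPn/negP; exact: H.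
have [i ij] : exists i : 'I_2, i != j.
  by move: j {gj}; apply: ord2_ind; [exists 1|exists 0].
pose e := Num.sg (grad f p 0 j).
have e0 : e != 0 by rewrite sgr_eq0.
have Cef := C1Z e Cf.
have [||del [r [L [gam [d0 r0 [g00 Hg] Hl Hz]]]]] := @zero_graph_pos _ p U i j Cef _ ij _ NU.
- by rewrite fp mulr0.
- by rewrite gradZ; [rewrite mxE -normrEsg normr_gt0|exact: Cf.1].
exists del, r, L, gam; split => //.
  split=> // x /Hg [h1 /eqP]; rewrite mulf_eq0 (negbTE e0) => /eqP h2 h3; by split.
by move=> z zr fz; apply: Hz => //; rewrite fz mulr0.
Qed.

Lemma dot_gt0 (v : plane R) : v != 0 -> 0 < dot v v.
Proof.
move=> v0; rewrite lt_neqAle dot2 addr_ge0 -?expr2 ?sqr_ge0 // andbT eq_sym.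
rewrite paddr_eq0 ?sqr_ge0 // !sqrf_eq0; apply: contra v0 => /andP[/eqP a /eqP b].
by apply/eqP/plane_eq; apply: ord2_ind; rewrite [RHS]mxE.
Qed.

Lemma dot_opp_split (g n : plane R) : dot g (- n) = - dot n n + dot (g - n) (- n).
Proof. by rewrite !dot2 !mxE; ring. Qed.

(** [f] decreases along the direction opposite to its gradient. *)
Lemma negative_value_nearby f p (r : R) : C1 f -> f p = 0 -> grad f p != 0 -> 0 < r ->
  exists2 w, `|w - p| < r & f w < 0.
Proof.
move=> Cf fp n0 r0; set n := grad f p in n0.
have N0 : 0 < `|n| by rewrite normr_gt0.
have nn0 := dot_gt0 n0.
have eta0 : 0 < dot n n / (4 * `|n|) by rewrite divr_gt0 // mulr_gt0.
have [r1 r10 Hr] := near_ball (C1_grad_near p Cf eta0).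
pose tau := Num.min r r1 / (2 * `|n|).
have rr0 : 0 < Num.min r r1 by rewrite lt_min r0 r10.
have tau0 : 0 < tau by rewrite divr_gt0 // mulr_gt0.
pose w := p + tau *: - n.
have wp : `|w - p| < Num.min r r1.
  rewrite /w addrC addKr normrZ normrN gtr0_norm // /tau.
  have -> : Num.min r r1 / (2 * `|n|) * `|n| = Num.min r r1 / 2.
    by field; rewrite gt_eqF.
  clear -rr0; lra.
exists w; first by apply: lt_le_trans wp _; rewrite ge_min lexx.
have [s s01] := mvt_plane p w Cf.1; rewrite fp subr0 => ->.
have wr : `|w - p| < r1 by apply: lt_le_trans wp _; rewrite ge_min lexx orbT.
have pr : `|p - p| < r1 by rewrite subrr normr0.
have Hg := Hr _ (segment_near s01 pr wr).
set g := grad f _ in Hg *.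
have -> : w - p = tau *: - n by rewrite /w addrC addKr.
rewrite dotZr pmulr_rlt0 //.
have -> : dot g (- n) = - dot n n + dot (g - n) (- n).
  exact: dot_opp_split.
have nN : `|- n| <= `|n| by rewrite normrN.
have := dot_bound Hg nN; rewrite -/n.
have -> : 2 * (dot n n / (4 * `|n|) * `|n|) = dot n n / 2.
  by field; rewrite gt_eqF.
rewrite ler_norml; clear -nn0; lra.
Qed.

Lemma mvt_real (g g1 : R -> R) (a b : R) : a < b ->
  (forall t, a <= t <= b -> is_derive (t : R^o) (1 : R) g (g1 t)) ->
  exists2 c, a < c < b & g b - g a = g1 c * (b - a).
Proof.
move=> ab dg.
have D x : x \in `]a, b[ -> is_derive (x : R^o) (1 : R) g (g1 x).
  by rewrite in_itv /= => /andP[h1 h2]; apply: dg; rewrite !ltW.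
have C : {within `[a, b], continuous (g : R -> R)}.
  apply: derivable_within_continuous => s; rewrite in_itv /= => sab.
  by have [] := dg s sab.
have [c] := @MVT R g g1 a b ab D C.
by rewrite in_itv /= => cab E; exists c.
Qed.

(** [g1 = g'] grows at least at the rate [m], so [g s] is at least
    [g 0 + g1 0 * s + m * s ^+ 2 / 4], which is positive; on its way
    up from a negative value it must cross zero with positive derivative, as
    it has a positive derivative earlier and [g1] increases. *)
Lemma convex_crossing (g g1 g2 : R -> R) (s m : R) : 0 < s -> 0 < m ->
  (forall t, 0 <= t <= s -> is_derive (t : R^o) (1 : R) g (g1 t)) ->
  (forall t, 0 <= t <= s -> is_derive (t : R^o) (1 : R) g1 (g2 t)) ->
  (forall t, 0 <= t <= s -> m <= g2 t) ->
  g 0 < 0 -> 0 < g 0 + g1 0 * s + m * s ^+ 2 / 4 ->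
  exists2 t, 0 < t <= s & g t = 0 /\ 0 < g1 t.
Proof.
move=> s0 m0 dg dg1 Hm g00 H.
have incr a b : 0 <= a -> a < b -> b <= s -> m * (b - a) <= g1 b - g1 a.
  move=> a0 ab bs; have [|c cab ->] := @mvt_real g1 g2 a b ab.
    by move=> t /andP[h1 h2]; apply: dg1; rewrite (le_trans a0 h1) (le_trans h2 bs).
  have /andP[c1 c2] := cab.
  rewrite ler_wpM2r ?subr_ge0 ?(ltW ab) //; apply: Hm.
  by rewrite (le_trans a0 (ltW c1)) (le_trans (ltW c2) bs).
have h0 : 0 < s / 2 by rewrite divr_gt0.
have hs : s / 2 < s by clear -s0; lra.
have gs : 0 < g s.
  have [|c /andP[c1 c2] E1] := @mvt_real g g1 0 (s / 2) h0.
    by move=> t /andP[h1 h2]; apply: dg; rewrite h1 (le_trans h2 (ltW hs)).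
  have [|c' /andP[c1' c2'] E2] := @mvt_real g g1 (s / 2) s hs.
    by move=> t /andP[h1 h2]; apply: dg; rewrite h2 (le_trans (ltW h0) h1).
  have I1 := incr 0 c (lexx _) c1 (ltW (lt_trans c2 hs)).
  have I2 := incr 0 c' (lexx _) (lt_trans h0 c1') (ltW c2').
  have mc : 0 < m * (c - 0) by rewrite mulr_gt0 // subr_gt0.
  have mc' : m * (s / 2) <= m * (c' - 0) by rewrite ler_pM2l // subr0 ltW.
  have J1 : g1 0 * (s / 2) <= g1 c * (s / 2).
    by rewrite ler_pM2r //; clear -I1 mc; lra.
  have J2 : (g1 0 + m * (s / 2)) * (s / 2) <= g1 c' * (s / 2).
    by rewrite ler_pM2r //; clear -I2 mc'; lra.
  have E : s - s / 2 = s / 2 by field.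
  rewrite E in E2; rewrite subr0 in E1.
  clear -E1 E2 J1 J2 H; rewrite expr2 in H; lra.
have C : {within `[0, s], continuous (g : R -> R)}.
  apply: derivable_within_continuous => t; rewrite in_itv /= => tt.
  by have [] := dg t tt.
have [|t] := @IVT R g 0 s 0 (ltW s0) C.
  by rewrite minElt maxElt (lt_trans g00 gs) (ltW g00) (ltW gs).
rewrite in_itv /= => /andP[t0 ts] gt.
have {}t0 : 0 < t.
  by rewrite lt_neqAle t0 andbT; apply/eqP => E; rewrite -E in gt; rewrite gt ltxx in g00.
exists t; first by rewrite t0 ts.
split=> //.
have [|c /andP[c1 c2] E1] := @mvt_real g g1 0 t t0.
  by move=> x /andP[h1 h2]; apply: dg; rewrite h1 (le_trans h2 ts).
have g1c : 0 < g1 c by rewrite -(pmulr_lgt0 _ (_ : 0 < t - 0)) ?subr_gt0 // -E1 gt sub0r oppr_gt0.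
have := incr c t (ltW c1) c2 ts.
have : 0 < m * (t - c) by rewrite mulr_gt0 // subr_gt0.
clear -g1c; lra.
Qed.

(** [h] is the derivative of [P] along [A]. At [p] the orbit of [A] is tangent to
    the locus [P = 0], and bends into [P > 0] since the second derivative is
    positive. An orbit starting slightly below [p], in [P < 0], therefore
    crosses the locus once in the past, downwards, and once in the future,
    upwards. *)
Lemma tangency_link A P h p U : C1field A -> C1 P -> C1 h ->
  (forall q, h q = dot (grad P q) (A q)) ->
  continuous (fun q => dot (grad h q) (A q)) ->
  P p = 0 -> h p = 0 -> 0 < dot (grad h p) (A p) -> grad P p != 0 -> nbhs p U ->
  exists z1 z2, [/\ U z1 /\ U z2, P z1 = 0 /\ P z2 = 0, h z1 < 0, 0 < h z2 &
    forall B, steer A B U z1 z2].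
Proof.
move=> CA CP Ch hE cl Pp hp l0 n0 NU; have cA := C1field_cont CA.
set l := fun q => dot (grad h q) (A q); set m := l p / 2.
have m0 : 0 < m by rewrite divr_gt0.
pose V := [set q | U q /\ `|A q - A p| <= 1 /\ `|l q - l p| <= m].
have NV : nbhs p V.
  exact: filterI NU (filterI (field_near p cA ltr01) (near_cont m0 (cl p))).
have lV q : V q -> m <= l q.
  by move=> [_ [_]]; rewrite ler_norml /m; clear; lra.
have bA q : V q -> `|A q| <= `|A p| + 1.
  move=> [_ [H _]]; rewrite -[A q](subrKC (A p)).
  by apply: le_trans (ler_normD _ _) _; rewrite lerD2l.
have [rho [s [rho0 s0 Hflow]]] := local_flow CA NV.
pose ep := m * s ^+ 2 / 16.
have ep0 : 0 < ep by rewrite divr_gt0 // mulr_gt0 // exprn_gt0.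
have eps0 : 0 < ep / s by rewrite divr_gt0.
have [r1 r10 Hr1] := near_ball (filterI (near_cont ep0 (C1_cont CP (x := p)))
   (near_cont eps0 (C1_cont Ch (x := p)))).
have [|w wr Pw] := @negative_value_nearby P p (Num.min rho r1) CP Pp n0.
  by rewrite lt_min rho0 r10.
have [|phi [phi0 Hphi]] := Hflow w.
  by apply: lt_le_trans wr _; rewrite ge_min lexx.
have [|] := Hr1 w.
  by apply: lt_le_trans wr _; rewrite ge_min lexx orbT.
rewrite Pp hp !subr0 => H1 H2.
have H3 : `|h w * s| <= ep by rewrite normrM (gtr0_norm s0) -ler_pdivlMr.
have msE : m * s ^+ 2 / 4 = 4 * ep by rewrite /ep; field.
have dP t : `|t| <= s -> is_derive (t : R^o) (1 : R) (P \o phi) (h (phi t)).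
  by move=> /Hphi [_ D]; rewrite hE; apply: derive_along_curve => //; exact: CP.1.
have dh t : `|t| <= s -> is_derive (t : R^o) (1 : R) (h \o phi) (l (phi t)).
  by move=> /Hphi [_ D]; apply: derive_along_curve => //; exact: Ch.1.
have flip (f df : R -> R) t : is_derive ((- t) : R^o) (1 : R) f (df (- t)) ->
    is_derive (t : R^o) (1 : R) (fun t => f (- t)) (- df (- t)).
  move=> D; have D1 : is_derive (t : R^o) (1 : R) (fun t : R => - t) (-1).
    exact: is_deriveNid.
  by have := @is_derive1_comp R f (fun t => - t) t _ _ D D1; rewrite mulrN1.
have [t2 /andP[t20 t2s] [z20 z2h]] : exists2 t, 0 < t <= s &
    P (phi t) = 0 /\ 0 < h (phi t).
  have [|||||t Ht HH] := @convex_crossing (P \o phi) (h \o phi) (l \o phi) s m s0 m0.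
  - by move=> t /andP[t0 ts]; apply: dP; rewrite ger0_norm.
  - by move=> t /andP[t0 ts]; apply: dh; rewrite ger0_norm.
  - by move=> t /andP[t0 ts]; apply: lV; have [] := Hphi t; rewrite ?ger0_norm.
  - by rewrite /= phi0.
  - rewrite /= phi0 msE; rewrite !ler_norml in H1 H3; clear -H1 H3 ep0; lra.
  by exists t.
(* The past crossing is the future crossing of the reversed orbit. *)
have [t1 /andP[t10 t1s] [z10 z1h]] : exists2 t, 0 < t <= s &
    P (phi (- t)) = 0 /\ 0 < - h (phi (- t)).
  have [|||||t Ht HH] := @convex_crossing (fun t => P (phi (- t)))
    (fun t => - h (phi (- t))) (fun t => l (phi (- t))) s m s0 m0.
  - move=> t /andP[t0 ts]; apply: (flip (P \o phi) (h \o phi)).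
    by apply: dP; rewrite normrN ger0_norm.
  - move=> t /andP[t0 ts].
    have D : is_derive (t : R^o) (1 : R) (fun t => h (phi (- t))) (- l (phi (- t))).
      by apply: (flip (h \o phi) (l \o phi)); apply: dh; rewrite normrN ger0_norm.
    by have := is_deriveN D; rewrite opprK.
  - by move=> t /andP[t0 ts]; apply: lV; have [] := Hphi (- t); rewrite ?normrN ?ger0_norm.
  - by rewrite /= oppr0 phi0.
  - rewrite /= oppr0 phi0 msE; rewrite !ler_norml in H1 H3; clear -H1 H3 ep0; lra.
  by exists t.
have VU : V `<=` U by move=> q [].
exists (phi (- t1)), (phi t2); split.
- have [h1 _] := Hphi (- t1) ltac:(by rewrite normrN gtr0_norm).
  have [h2 _] := Hphi t2 ltac:(by rewrite gtr0_norm).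
  by split; apply: VU.
- by [].
- by rewrite -oppr_gt0.
- by [].
move=> B; apply: (steer_sub VU).
have t12 : - t1 < t2 by apply: lt_trans t20; rewrite oppr_lt0.
apply: (@steer_flow _ A B V phi (- t1) t2 (`|A p| + 1) t12) => // t tt.
apply: Hphi; rewrite ler_norml; clear -tt t1s t2s; lra.
Qed.

End Graph.

(** * Local controllability along the locus *)
(** The classes of a locally constant equivalence relation are both open and
    closed. *)
Lemma connected_one_class (T : topologicalType) (S : set T) (E : T -> T -> Prop) :
  connected S ->
  (forall p q, S p -> S q -> E p q -> E q p) ->
  (forall p q r, S p -> S q -> S r -> E p q -> E q r -> E p r) ->
  (forall p, S p -> exists O : set T, [/\ open O, O p & forall q, S q -> O q -> E p q]) ->
  forall p q, S p -> S q -> E p q.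
Proof.
move=> cS sym tr loc p q Sp Sq.
pose nice q (O : set T) := [/\ S q, open O & forall q', S q' -> O q' -> E q q'].
have open_nice (F : set T) : open (\bigcup_(i in [set i : T * set T | F i.1 /\ nice i.1 i.2]) i.2).
  by apply: bigcup_open => -[x O] /= [_ []].
have self x : S x -> exists O, nice x O /\ O x.
  by move=> Sx; have [V [oO Ox HO]] := loc x Sx; exists V.
have BS : [set x | S x /\ E p x] = S.
  apply: cS.
  - by exists p; split=> //; have [V [[_ _ HO] Op]] := self p Sp; apply: HO.
  - eexists; first exact: (open_nice [set x | E p x]).
    apply/seteqP; split=> x /=.
      move=> [Sx Ex]; split=> //; have [V [nO Ox]] := self x Sx.
      by exists (x, V).
    move=> [Sx [[y O] /= [Ey [Sy oO HO]] Ox]]; split=> //.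
    by apply: (tr p y x) => //; exact: HO.
  - eexists; first exact: (open_closedC (open_nice [set x | ~ E p x])).
    apply/seteqP; split=> x /=.
      move=> [Sx Ex]; split=> // -[[y O] /= [Ey [Sy oO HO]] Ox]; apply: Ey.
      by apply: (tr p x y) => //; apply: sym => //; exact: HO.
    move=> [Sx H]; split=> //; apply: contrapT => nE; apply: H.
    by have [V [nO Ox]] := self x Sx; exists (x, V).
by have [] : [set x | S x /\ E p x] q by rewrite BS.
Qed.

Section LocalControl.
Variable R : realType.
Implicit Types (A B X Y : plane R -> plane R) (p z w d v : plane R) (U W : set (plane R))
  (f P Q h : plane R -> R).

Definition opposed X Y (q : plane R) := exists2 k : R, 0 < k & Y q = - k *: X q.

(** Two nearby points of the locus differ by a vector that is not parallel to
    [X z], so one of the two sides of the locus has a cone containing it. Of the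
    two fields, one enters that side and the other one leaves it, because they
    are opposite; this fixes the roles in the one-sided steering. *)
Lemma transversal_local X Y Q z U W : C1field X -> C1field Y -> C1 Q ->
  (forall q, Q q = det2 (X q) (Y q)) -> Q z = 0 -> dot (grad Q z) (X z) != 0 ->
  nbhs z W -> (forall q, W q -> Q q = 0 -> opposed X Y q) -> nbhs z U ->
  exists2 r : R, 0 < r & forall z1 z2, `|z1 - z| < r -> `|z2 - z| < r ->
    Q z1 = 0 -> Q z2 = 0 -> steer X Y U z1 z2.
Proof.
move=> CX CY CQ QE Qz h0 NW HW NU.
have [k k0 Yz] := HW z (nbhs_singleton NW) Qz.
have dQ q : differentiable Q q by exact: CQ.1.
have k'0 : 0 < k^-1 by rewrite invr_gt0.
have Xz : X z = - k^-1 *: Y z.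
  by rewrite Yz scalerA mulrN mulNr opprK mulVf ?scale1r // gt_eqF.
(* The sign e selects the side of the locus on which the motion takes place. *)
have half (e : R) : e * e = 1 -> exists2 r : R, 0 < r &
    forall z1 z2, `|z1 - z| < r -> `|z2 - z| < r ->
    Q z1 = 0 -> Q z2 = 0 -> 0 < e * det2 (X z) (z2 - z1) -> steer X Y U z1 z2.
  move=> ee.
  have gE v : dot (grad (fun q => e * Q q) z) v = e * dot (grad Q z) v.
    by rewrite gradZ // !dot2 !mxE; ring.
  have CP := C1Z e CQ.
  have e0 : e != 0 by apply/eqP => E; move: ee; rewrite E mul0r => /eqP; rewrite eq_sym oner_eq0.
  case: (ltrgtP 0 (e * dot (grad Q z) (X z))) => [h|h|/esym/eqP]; last 1 first.
  - by rewrite mulf_eq0 (negbTE e0) (negbTE h0).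
  - have [||r r0 Hr] := @transversal_steer_oneside R X Y _ z U k e CX CY CP k0 ee Yz _ _ NU.
    + by move=> q; rewrite QE.
    + by rewrite gE.
    exists r => // z1 z2 h1 h2 Q1 Q2 D; apply: Hr => //; by rewrite ?Q1 ?Q2 mulr0.
  - have ee' : (- e) * (- e) = 1 by rewrite mulNr mulrN opprK.
    have [||r r0 Hr] := @transversal_steer_oneside R Y X _ z U k^-1 (- e) CY CX CP k'0 ee' Xz _ _ NU.
    + by move=> q; rewrite QE det2C mulrN mulNr.
    + by rewrite gE Yz dotZr mulrCA mulNr oppr_gt0 pmulr_rlt0.
    exists r => // z1 z2 h1 h2 Q1 Q2 D; apply: steer_swap; apply: Hr => //.
    + by rewrite Q1 mulr0.
    + by rewrite Q2 mulr0.
    + by rewrite Yz det2Zl mulrCA !mulNr mulrN opprK pmulr_rgt0.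
have [r1 r10 H1] := half 1 (mulr1 1).
have [r2 r20 H2] := half (-1) ltac:(by rewrite mulrNN mulr1).
have [r3 [c [r30 c0 H3]]] := secant_det_lower_bound CQ h0.
have [r4 r40 H4] := near_ball (filterI NU NW).
exists (Num.min (Num.min r1 r2) (Num.min r3 r4)).
  by rewrite !lt_min r10 r20 r30 r40.
move=> z1 z2; rewrite !lt_min => /andP[/andP[a1 a2] /andP[a3 a4]].
move=> /andP[/andP[b1 b2] /andP[b3 b4]] Q1 Q2.
have [E|ne] := eqVneq z1 z2.
  rewrite -E; have [U1 W1] := H4 _ a4; have [k1 k10 E1] := HW _ W1 Q1.
  exact: steer_refl U1 k10 E1.
have := H3 z1 z2 a3 b3; rewrite Q1 Q2 => /(_ erefl) Hd.
have d0 : 0 < c * `|z2 - z1| by rewrite mulr_gt0 // normr_gt0 subr_eq0 eq_sym.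
have {}Hd := lt_le_trans d0 Hd; rewrite normr_gt0 in Hd.
case: (ltrgtP 0 (det2 (X z) (z2 - z1))) => [h|h|h].
- by apply: H1 => //; rewrite mul1r.
- by apply: H2 => //; rewrite mulN1r oppr_gt0.
- by rewrite -h eqxx in Hd.
Qed.

Lemma dot_det2 (n v d : plane R) :
  dot n d * dot v v = dot n v * dot v d + det2 v n * det2 v d.
Proof. by rewrite !dot2 /det2; ring. Qed.

(** [Q] and [h] have independent gradients at [p]: [X p] is orthogonal to the
    first one but not to the second one. Hence a secant between two common zeros
    would be both nearly parallel to [X p] and uniformly transversal to it. *)
Lemma tangency_isolated X Q h p : C1 Q -> C1 h -> Q p = 0 -> h p = 0 ->
  dot (grad Q p) (X p) = 0 -> dot (grad h p) (X p) != 0 -> grad Q p != 0 ->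
  exists2 r : R, 0 < r & forall z, `|z - p| < r -> Q z = 0 -> h z = 0 -> z = p.
Proof.
move=> CQ Ch Qp hp nX l0 n0.
have X0 : X p != 0.
  by apply: contraNneq l0 => ->; rewrite dot2 !mxE !mulr0 addr0.
set v := X p in nX l0 X0 *; set n := grad Q p in nX n0 *.
have vv0 := dot_gt0 X0; have nn0 := dot_gt0 n0.
have D0 : det2 v n != 0.
  have := dot_det2 n v n; rewrite nX mul0r add0r => E.
  by apply: contraTneq (mulr_gt0 nn0 vv0) => D; rewrite E D mul0r ltxx.
have [r1 [c [r10 c0 H1]]] := secant_det_lower_bound Ch l0.
pose eta := c * `|det2 v n| / (4 * dot v v).
have Dn0 : 0 < `|det2 v n| by rewrite normr_gt0.
have eta0 : 0 < eta by rewrite divr_gt0 // mulr_gt0.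
have [r2 r20 H2] := secant_almost_tangent p CQ eta0.
exists (Num.min r1 r2); first by rewrite lt_min r10 r20.
move=> z; rewrite lt_min => /andP[z1 z2] Qz hz.
have pp (r : R) : 0 < r -> `|p - p| < r by rewrite subrr normr0.
have := H1 p z (pp _ r10) z1; rewrite hz hp => /(_ erefl) I1.
have := H2 p z (pp _ r20) z2; rewrite Qz Qp => /(_ erefl) I2.
apply/eqP; rewrite -subr_eq0 -normr_le0.
set d := z - p in I1 I2 *; rewrite -/n in I2.
have E := dot_det2 n v d; rewrite nX mul0r add0r in E.
have E' : `|dot n d| * dot v v = `|det2 v n| * `|det2 v d|.
  by rewrite -normrM -E normrM (gtr0_norm vv0).
have I3 : `|dot n d| * dot v v <= 2 * (eta * `|d|) * dot v v by rewrite ler_pM2r.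
have I4 : `|det2 v n| * (c * `|d|) <= `|det2 v n| * `|det2 v d| by rewrite ler_pM2l.
have E3 : 2 * (eta * `|d|) * dot v v = `|det2 v n| * (c * `|d|) / 2.
  by rewrite /eta; field; rewrite gt_eqF.
rewrite E3 E' in I3; have := le_trans I4 I3.
set y := _ * _ => I5; have y0 : y <= 0 by clear -I5; lra.
by move: y0; rewrite /y pmulr_rle0 // pmulr_rle0.
Qed.

Lemma dot_gradZ f (e : R) q v : differentiable f q ->
  dot (grad (fun q => e * f q) q) v = e * dot (grad f q) v.
Proof. by move=> df; rewrite gradZ // !dot2 !mxE; ring. Qed.

Lemma tangency_link_sg A Q h p U : C1field A -> C1 Q -> C1 h ->
  (forall q, h q = dot (grad Q q) (A q)) ->
  continuous (fun q => dot (grad h q) (A q)) ->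
  Q p = 0 -> h p = 0 -> dot (grad h p) (A p) != 0 -> grad Q p != 0 -> nbhs p U ->
  exists z1 z2, let e := Num.sg (dot (grad h p) (A p)) in
   [/\ U z1 /\ U z2, Q z1 = 0 /\ Q z2 = 0, e * h z1 < 0, 0 < e * h z2 &
    forall B, steer A B U z1 z2].
Proof.
move=> CA CQ Ch hE cl Qp hp l0 n0 NU.
set e := Num.sg (dot (grad h p) (A p)).
have e0 : e != 0 by rewrite sgr_eq0.
have gE f q v (Cf : C1 f) := dot_gradZ e v (Cf.1 q).
have [||||||z1 [z2 [h1 [h2 h2'] h3 h4 h5]]] :=
  @tangency_link R A (fun q => e * Q q) (fun q => e * h q) p U CA (C1Z e CQ) (C1Z e Ch) _ _ _ _ _ _ NU.
- by move=> q; rewrite hE; exact: esym (gE Q q (A q) CQ).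
- have -> : (fun q => dot (grad (fun q => e * h q) q) (A q)) =
      (fun q => e * dot (grad h q) (A q)).
    by apply/funext => q; exact: (gE h q (A q) Ch).
  move=> q; apply: (@cvgM _ _ (nbhs q) _ (cst e)); [exact: cvg_cst|exact: cl].
- by rewrite Qp mulr0.
- by rewrite hp mulr0.
- by rewrite (gE h p (A p) Ch) -normrEsg normr_gt0.
- by rewrite gradZ; [rewrite scaler_eq0 negb_or e0|exact: CQ.1].
exists z1, z2; split => //.
by move: h2 h2' => /eqP + /eqP; rewrite !mulf_eq0 (negbTE e0) => /eqP ? /eqP ?.
Qed.

(** Near a tangency point [p] the locus is an arc, and [p] splits it into two
    halves on which the transversality [hX] has no zero. Each half is connected,
    so by transversal controllability all of its points can be steered to
    each other. An orbit of [X] leads from the half where [hX] has the sign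
    opposite to that of its derivative to the other half; as the fields are
    opposite, [hY] has the opposite sign to [hX], and an orbit of [Y] leads
    back. The point [p] itself is excluded: either what it can reach nearby, or
    what can reach it, lies on one side of the orbit through it. *)
Lemma tangency_local X Y Q hX hY p U W : C1field X -> C1field Y -> C1 Q -> C1 hX -> C1 hY ->
  (forall q, Q q = det2 (X q) (Y q)) ->
  (forall q, hX q = dot (grad Q q) (X q)) -> (forall q, hY q = dot (grad Q q) (Y q)) ->
  continuous (fun q => dot (grad hX q) (X q)) ->
  continuous (fun q => dot (grad hY q) (Y q)) ->
  Q p = 0 -> hX p = 0 -> grad Q p != 0 ->
  dot (grad hX p) (X p) != 0 ->
  Num.sg (dot (grad hY p) (Y p)) = Num.sg (dot (grad hX p) (X p)) ->
  nbhs p W -> (forall q, W q -> Q q = 0 -> opposed X Y q) -> nbhs p U ->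
  exists2 r : R, 0 < r & forall z1 z2, `|z1 - p| < r -> `|z2 - p| < r ->
    Q z1 = 0 -> Q z2 = 0 -> hX z1 != 0 -> hX z2 != 0 -> steer X Y U z1 z2.
Proof.
move=> CX CY CQ ChX ChY QE hXE hYE clX clY Qp hp n0 l0 lsg NW HW NU.
have l0' : dot (grad hY p) (Y p) != 0 by rewrite -sgr_eq0 lsg sgr_eq0.
have [r1 r10 H1] : exists2 r : R, 0 < r &
    forall z, `|z - p| < r -> Q z = 0 -> hX z = 0 -> z = p.
  by apply: (@tangency_isolated X) => //; rewrite -hXE.
have NB (r : R) : 0 < r -> nbhs p [set q | `|q - p| < r] by move=> r0; apply: (ball_near r0).
pose U1 := U^° `&` W^° `&` [set q | `|q - p| < r1].
have NU1 : nbhs p U1.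
  by apply: filterI; [apply: filterI; exact: nbhs_interior|exact: NB].
have [del [r2 [L [gam [del0 r20 [g0 Hg] Hl Hz]]]]] := zero_graph CQ Qp n0 NU1.
pose U2 := U1 `&` [set q | `|q - p| < r2].
have NU2 : nbhs p U2 by apply: filterI; [exact: NU1|exact: NB].
pose e := Num.sg (dot (grad hX p) (X p)).
have [a [b /= [[Ua Ub] [Qa Qb] ha hb Sab]]] :=
  tangency_link_sg CX CQ ChX hXE clX Qp hp l0 n0 NU2.
have WU1 q : U1 q -> W q by move=> [[_ /interior_subset]].
have hXY q : U1 q -> Q q = 0 -> exists2 k : R, 0 < k & hY q = - k * hX q.
  by move=> /WU1 Wq /(HW q Wq) [k k0 E]; exists k => //; rewrite hYE hXE E dotZr.
have hYp : hY p = 0.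
  by have [k _ ->] := hXY p (nbhs_singleton NU1) Qp; rewrite hp mulr0.
have [c [d /= [[Uc Ud] [Qc Qd] hc hd Scd]]] :=
  tangency_link_sg CY CQ ChY hYE clY Qp hYp l0' n0 NU2.
rewrite lsg -/e in hc hd; rewrite -/e in ha hb.
have {}hc : 0 < e * hX c.
  have [k k0 E] := hXY c Uc.1 Qc; move: hc.
  by rewrite E mulrCA mulNr oppr_lt0 (pmulr_rgt0 _ k0).
have {}hd : e * hX d < 0.
  have [k k0 E] := hXY d Ud.1 Qd; move: hd.
  by rewrite E mulrCA mulNr oppr_gt0 (pmulr_rlt0 _ k0).
have {}Scd : steer X Y U2 c d by apply: steer_swap; exact: Scd.
have U2U : U2 `<=` U by move=> q [[[/interior_subset]]].
have {Sab} Sab := steer_sub U2U (Sab Y); have {Scd} Scd := steer_sub U2U Scd.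
have [xa xad Ea] := Hz a Ua.2 Qa; have [xb xbd Eb] := Hz b Ub.2 Qb.
have [xc xcd Ec] := Hz c Uc.2 Qc; have [xd xdd Ed] := Hz d Ud.2 Qd.
pose arc (s : bool) : set R := [set x | `|x| < del /\ if s then 0 < x else x < 0].
have arc_conn s : connected (arc s).
  have -> : arc s = [set` if s then `]0, del[ else `](- del), 0[].
    apply/seteqP; split=> x; rewrite /arc /=; case: s; rewrite in_itv /= ltr_norml.
    - by move=> [/andP[_ ->] ->].
    - by move=> [/andP[-> _] ->].
    - by move=> /andP[x0 xd']; split=> //; rewrite xd' andbT (lt_trans _ x0) // oppr_lt0.
    - by move=> /andP[x0 xd']; split=> //; rewrite x0 (lt_trans xd').
  by apply/connected_intervalP; case: s; exact: interval_is_interval.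
have arc_h s x : arc s x -> hX (gam x) != 0.
  move=> [xd' sx]; have [[_ Bx] Qx E] := Hg x xd'.
  apply/eqP => h0; have := E (H1 _ Bx Qx h0) => x0.
  by move: sx; rewrite x0 ltxx; case: s.
have cgam x (r : R) : `|x| < del -> 0 < r -> exists O : set R, [/\ open O, O x &
    forall y, `|y| < del -> O y -> `|gam y - gam x| < r].
  move=> xdl r0; have L1 : 0 < `|L| + 1 by rewrite ltr_wpDl.
  have q0 : 0 < r / (`|L| + 1) by rewrite divr_gt0.
  exists `](x - r / (`|L| + 1)), (x + r / (`|L| + 1))[%classic; split.
  - exact: interval_open.
  - by rewrite /= in_itv /= ltrBlDr ltrDl q0.
  - move=> y yd /=; rewrite in_itv /= -ltr_distl => Hy.
    apply: le_lt_trans (Hl y x yd xdl) _.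
    apply: (@le_lt_trans _ _ ((`|L| + 1) * `|y - x|)).
      by rewrite ler_wpM2r // (le_trans (ler_norm L)) // lerDl.
    by rewrite mulrC -ltr_pdivlMr.
have arcS s x y : arc s x -> arc s y -> steer X Y U (gam x) (gam y) /\ steer X Y U (gam y) (gam x).
  apply: (connected_one_class (E := fun x y => steer X Y U (gam x) (gam y) /\ steer X Y U (gam y) (gam x)) (@arc_conn s)).
  - by move=> {}x {}y _ _ [].
  - move=> {}x {}y z _ _ _ [s1 s2] [s3 s4]; split.
      exact: steer_trans s1 s3.
    exact: steer_trans s4 s2.
  - move=> {}x ax; have [xdl _] := ax; have [Ux Qx _] := Hg x xdl.
    have hx := arc_h _ _ ax; rewrite hXE in hx.
    have [r' r'0 Hr'] := transversal_local CX CY CQ QE Qx hx (Ux.1.2) HW (Ux.1.1).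
    have [V [oV Vx HV]] := cgam x r' xdl r'0.
    have xx : `|gam x - gam x| < r' by rewrite subrr normr0.
    exists V; split=> // t [ydl _] Vy; have [_ Qy _] := Hg t ydl.
    by split; apply: Hr' => //; exact: HV.
pose f q := e * hX q.
have e0 : e != 0 by rewrite sgr_eq0.
have arcE s x y : arc s x -> arc s y -> (0 < f (gam x)) = (0 < f (gam y)).
  apply: (connected_one_class (E := fun x y => (0 < f (gam x)) = (0 < f (gam y))) (@arc_conn s)).
  - by [].
  - by move=> {}x {}y z _ _ _ -> ->.
  - move=> {}x ax; have [xdl _] := ax.
    have fx : f (gam x) != 0 by rewrite mulf_neq0 // (arc_h _ _ ax).
    have f0 : 0 < `|f (gam x)| / 2 by rewrite divr_gt0 // normr_gt0.
    have [r' r'0 Hr'] := near_ball (near_cont f0 (C1_cont (C1Z e ChX) (x := gam x))).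
    have [V [oV Vx HV]] := cgam x r' xdl r'0.
    exists V; split=> // t [ydl _] Vy; have := Hr' _ (HV t ydl Vy).
    rewrite -/(f (gam t)) -/(f (gam x)) ler_norml.
    move: fx; case: (ltrgtP 0 (f (gam x))) => // [h|h] _.
      rewrite (gtr0_norm h) => H; symmetry; clear -H h; lra.
    rewrite (ltr0_norm h) => H; symmetry; apply/negbTE; rewrite -leNgt.
    clear -H h; lra.
have arc_of x : `|x| < del -> hX (gam x) != 0 -> arc (0 < x) x.
  move=> xdl hx; split=> //; case: (ltrgtP 0 x) => // x0.
  by move: hx; rewrite -x0 g0 hp eqxx.
have ha' : hX (gam xa) != 0 by rewrite -Ea; apply: contraTneq ha => ->; rewrite mulr0 ltxx.
have hb' : hX (gam xb) != 0 by rewrite -Eb; apply: contraTneq hb => ->; rewrite mulr0 ltxx.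
have hc' : hX (gam xc) != 0 by rewrite -Ec; apply: contraTneq hc => ->; rewrite mulr0 ltxx.
have hd' : hX (gam xd) != 0 by rewrite -Ed; apply: contraTneq hd => ->; rewrite mulr0 ltxx.
have differ x y : `|x| < del -> `|y| < del -> f (gam x) < 0 -> 0 < f (gam y) ->
    (0 < x) = ~~ (0 < y).
  move=> xdl ydl fx fy.
  have ax : arc (0 < x) x.
    by apply: arc_of => //; apply: contraTneq fx => E; rewrite /f E mulr0 ltxx.
  have ay : arc (0 < y) y.
    by apply: arc_of => //; apply: contraTneq fy => E; rewrite /f E mulr0 ltxx.
  have [E|] := boolP ((0 < x) == (0 < y)); last by case: (0 < x); case: (0 < y).
  move: ax; rewrite (eqP E) => ax; have := arcE _ _ _ ax ay.
  by rewrite fy ltNge (ltW fx).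
have sab : (0 < xa) = ~~ (0 < xb) by apply: differ => //; rewrite -?Ea -?Eb.
have sac : (0 < xa) = ~~ (0 < xc) by apply: differ => //; rewrite -?Ea -?Ec.
have sdb : (0 < xd) = ~~ (0 < xb) by apply: differ => //; rewrite -?Ed -?Eb.
exists r2 => // z1 z2 b1 b2 Q1 Q2 h1 h2.
have [x1 d1 E1] := Hz z1 b1 Q1; have [x2 d2 E2] := Hz z2 b2 Q2.
rewrite E1 in h1 *; rewrite E2 in h2 *.
have a1 := arc_of _ d1 h1; have a2 := arc_of _ d2 h2.
have aa := arc_of _ xad ha'; have ab := arc_of _ xbd hb'.
have ac := arc_of _ xcd hc'; have ad := arc_of _ xdd hd'.
have same x y : arc (0 < x) x -> arc (0 < y) y -> (0 < x) = (0 < y) ->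
    steer X Y U (gam x) (gam y).
  by move=> ax ay E; rewrite E in ax; have [] := arcS _ _ _ ax ay.
rewrite Ea Eb in Sab; rewrite Ec Ed in Scd.
have [E|ne] := boolP ((0 < x1) == (0 < x2)); first by apply: same => //; exact/eqP.
have [E|ne'] := boolP ((0 < x1) == (0 < xa)).
  apply: steer_trans (same _ _ a1 aa (eqP E)) _.
  apply: steer_trans Sab _; apply: same => //.
  by move: ne; rewrite (eqP E) sab; case: (0 < xb); case: (0 < x2).
apply: steer_trans (same _ _ a1 ac _) _.
  by move: ne'; rewrite sac; case: (0 < x1); case: (0 < xc).
apply: steer_trans Scd _; apply: same => //.
rewrite sdb -sab; move: ne ne'; by case: (0 < x1); case: (0 < x2); case: (0 < xa).
Qed.

End LocalControl.

(** * Regularity of the determinant and of its Lie derivatives *)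
Section Regularity.
Variable R : realType.
Implicit Types (X Y : plane R -> plane R) (p v : plane R) (f g Q h : plane R -> R).

(** The scalar counterpart of [Ck], for which products are available. *)
Fixpoint scalar_Ck (k : nat) f : Prop :=
  match k with
  | 0%N => continuous f
  | k'.+1 => (forall p, differentiable f p) /\ forall v, scalar_Ck k' ('D_v f)
  end.

Definition scalar_smooth f := forall k, scalar_Ck k f.

Lemma scalar_Ck_coord k X i : Ck k X -> scalar_Ck k (fun p => X p 0 i).
Proof.
elim: k X => [|k IH] X /=.
  move=> cX p; apply: (@continuous_comp _ _ _ X (fun M : plane R => M 0 i)).
    exact: cX.
  exact: coord_continuous.
move=> [dX cX]; split.
  move=> p; apply: (@differentiable_comp _ _ _ _ X (fun M : plane R => M 0 i : R)).
    exact: dX.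
  exact: differentiable_coord.
move=> v; rewrite (_ : 'D_v _ = (fun p => 'D_v X p 0 i)); first exact: IH.
apply/funext => p; rewrite derive_mx ?mxE //; exact: diff_derivable.
Qed.

Lemma scalar_Ck_cont k f : scalar_Ck k f -> continuous f.
Proof. by case: k => [//|k] [df _] p; exact: differentiable_continuous. Qed.

Lemma scalar_CkW k f : scalar_Ck k.+1 f -> scalar_Ck k f.
Proof.
elim: k f => [|k IH] f; first exact: scalar_Ck_cont.
by move=> [df cf]; split=> // v; apply: IH; exact: cf.
Qed.

Lemma scalar_CkD k f g : scalar_Ck k f -> scalar_Ck k g -> scalar_Ck k (fun p => f p + g p).
Proof.
elim: k f g => [|k IH] f g /=; first by move=> cf cg p; apply: continuousD; [exact: cf|exact: cg].
move=> [df cf] [dg cg]; split; first by move=> p; apply: differentiableD.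
move=> v; rewrite (_ : 'D_v _ = (fun p => 'D_v f p + 'D_v g p)); first exact: IH.
by apply/funext => p; apply: deriveD; exact: diff_derivable.
Qed.

Lemma scalar_CkM k f g : scalar_Ck k f -> scalar_Ck k g -> scalar_Ck k (fun p => f p * g p).
Proof.
elim: k f g => [|k IH] f g; first by move=> cf cg p; apply: continuousM; [exact: cf|exact: cg].
move=> Cf Cg; have [df cf] := Cf; have [dg cg] := Cg.
split; first by move=> p; apply: differentiableM.
move=> v; rewrite (_ : 'D_v _ = (fun p => f p * 'D_v g p + g p * 'D_v f p)); last first.
  by apply/funext => p; apply: deriveM; exact: diff_derivable.
by apply: scalar_CkD; apply: IH; [exact: scalar_CkW|exact: cg|exact: scalar_CkW|exact: cf].
Qed.

Lemma scalar_smoothD f g : scalar_smooth f -> scalar_smooth g -> scalar_smooth (fun p => f p + g p).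
Proof. by move=> sf sg k; apply: scalar_CkD. Qed.

Lemma scalar_smoothM f g : scalar_smooth f -> scalar_smooth g -> scalar_smooth (fun p => f p * g p).
Proof. by move=> sf sg k; apply: scalar_CkM. Qed.

Lemma scalar_smooth_cst (c : R) : scalar_smooth (cst c).
Proof.
move=> k; elim: k c => [|k IH] c; first by move=> p; exact: cst_continuous.
split; first by move=> p; exact: differentiable_cst.
by move=> v; rewrite (_ : 'D_v _ = cst 0) //; apply/funext => p; rewrite derive_cst.
Qed.

Lemma scalar_smooth_coord X i : smooth X -> scalar_smooth (fun p => X p 0 i).
Proof. by move=> sX k; exact: scalar_Ck_coord (sX k). Qed.

Lemma scalar_smooth_deriv f v : scalar_smooth f -> scalar_smooth ('D_v f).
Proof. by move=> sf k; have [_] := sf k.+1; apply. Qed.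

Lemma scalar_smooth_C1 f : scalar_smooth f -> C1 f.
Proof.
by move=> sf; split; [have [] := sf 1%N|move=> i; have [_] := sf 1%N; apply].
Qed.

Lemma smooth_C1field X : smooth X -> C1field X.
Proof. by move=> sX i; apply: scalar_smooth_C1; exact: scalar_smooth_coord. Qed.

Lemma scalar_smooth_det X Y : smooth X -> smooth Y -> scalar_smooth (detXY X Y).
Proof.
move=> sX sY; rewrite (_ : detXY X Y = (fun p => X p 0 0 * Y p 0 1 +
    (cst (-1) p) * (X p 0 1 * Y p 0 0))); last first.
  by apply/funext => p; rewrite detXY2 /det2 /= mulN1r.
by apply: scalar_smoothD; [|apply: (scalar_smoothM (scalar_smooth_cst (-1)))];
  apply: scalar_smoothM; exact: scalar_smooth_coord.
Qed.

Lemma scalar_smooth_lie X f : smooth X -> scalar_smooth f -> scalar_smooth (lie X f).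
Proof.
move=> sX sf.
rewrite (_ : lie X f = (fun p => 'D_(delta_mx 0 0 : plane R) f p * X p 0 0 +
    'D_(delta_mx 0 1 : plane R) f p * X p 0 1)); last first.
  by apply/funext => p; rewrite /lie dot2 !mxE.
by apply: scalar_smoothD; (apply: scalar_smoothM; [exact: scalar_smooth_deriv|exact: scalar_smooth_coord]).
Qed.

(** Coordinates of the identity that writes
    [(grad Q . Y) X - (grad Q . X) Y] as [Q] times a rotated gradient of [Q]. *)
Lemma lie_combination0 (g x y : plane R) :
  dot g y * x 0 0 = dot g x * y 0 0 + 1 * (g 0 1 * det2 x y).
Proof. by rewrite !dot2 /det2; ring. Qed.

Lemma lie_combination1 (g x y : plane R) :
  dot g y * x 0 1 = dot g x * y 0 1 + (-1) * (g 0 0 * det2 x y).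
Proof. by rewrite !dot2 /det2; ring. Qed.

(** The combination [lie Y Q *: X - lie X Q *: Y] is a multiple of [Q]. Deriving
    this identity at a tangency point in the direction [X p], where [Q], both
    Lie derivatives and the derivative of [Q] in that direction vanish, shows
    that the derivatives of [lie Y Q] and [lie X Q] differ by the factor [- k];
    as [Y p = - k *: X p] too, the second Lie derivatives differ by [k ^+ 2]. *)
Lemma lie_lie_sg X Y (Q := detXY X Y) p (k : R) : smooth X -> smooth Y ->
  Q p = 0 -> lie X Q p = 0 -> X p != 0 -> 0 < k -> Y p = - k *: X p ->
  Num.sg (lie Y (lie Y Q) p) = Num.sg (lie X (lie X Q) p).
Proof.
move=> sX sY Qp hp X0 k0 Yp.
have sQ := scalar_smooth_det sX sY; rewrite -/Q in sQ.
have shX := scalar_smooth_lie sX sQ; have shY := scalar_smooth_lie sY sQ.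
have dsm f q v : scalar_smooth f -> is_derive q v f ('D_v f q).
  by move=> sf; apply: derivableP; apply: diff_derivable; have [] := sf 1%N.
have hYp : lie Y Q p = 0.
  by move: hp; rewrite /lie Yp dotZr => ->; rewrite mulr0.
set v := X p.
have key (i j : 'I_2) (c : R) :
    (forall q, lie Y Q q * X q 0 i = lie X Q q * Y q 0 i + c * ('D_(delta_mx 0 j : plane R) Q q * Q q)) ->
    v 0 i * 'D_v (lie Y Q) p = - k * v 0 i * 'D_v (lie X Q) p.
  move=> E.
  have D1 := is_deriveM (dsm _ p v shY) (dsm (fun q => X q 0 i) p v (scalar_smooth_coord i sX)).
  have D2 := is_deriveM (dsm _ p v shX) (dsm (fun q => Y q 0 i) p v (scalar_smooth_coord i sY)).
  have D3 := is_deriveM (dsm _ p v (scalar_smooth_deriv (delta_mx 0 j : plane R) sQ)) (dsm _ p v sQ).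
  have D4 := is_deriveD D2 (is_deriveZ c D3).
  have F : (lie Y Q * (fun q => X q 0 i) : plane R -> R) =
      lie X Q * (fun q => Y q 0 i) + c *: ('D_(delta_mx 0 j : plane R) Q * Q).
    by apply/funext => q; exact: E.
  rewrite F in D1.
  have := derive_val (is_derive := D1); rewrite (derive_val (is_derive := D4)).
  have Dv : 'D_v Q p = 0 by rewrite deriv_dot //; have [] := sQ 1%N.
  rewrite hp hYp Qp Dv !scale0r !scaler0 !add0r scaler0 addr0 /GRing.scale /= => <-.
  by rewrite Yp !mxE.
have E0 q : lie Y Q q * X q 0 0 = lie X Q q * Y q 0 0 +
    1 * ('D_(delta_mx 0 1 : plane R) Q q * Q q).
  rewrite /lie -grad_coord; move: (grad Q q) => g; rewrite /Q detXY2; exact: lie_combination0.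
have E1 q : lie Y Q q * X q 0 1 = lie X Q q * Y q 0 1 +
    (-1) * ('D_(delta_mx 0 0 : plane R) Q q * Q q).
  rewrite /lie -grad_coord; move: (grad Q q) => g; rewrite /Q detXY2; exact: lie_combination1.
have K0 := key _ _ _ E0; have K1 := key _ _ _ E1.
have K : 'D_v (lie Y Q) p = - k * 'D_v (lie X Q) p.
  have [i vi] : exists i, v 0 i != 0.
    apply/not_existsP => H; move/eqP: X0; apply; apply/plane_eq => i.
    by rewrite [RHS]mxE; apply/eqP/negPn/negP; exact: H.
  have Ki : v 0 i * 'D_v (lie Y Q) p = - k * v 0 i * 'D_v (lie X Q) p.
    by move: i {vi}; apply: ord2_ind.
  by apply: (mulfI vi); rewrite Ki; ring.
have -> : lie Y (lie Y Q) p = k ^+ 2 * lie X (lie X Q) p.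
  rewrite {1}/lie Yp dotZr -deriv_dot; last by have [] := shY 1%N.
  rewrite -/v K {2}/lie -deriv_dot; last by have [] := shX 1%N.
  by rewrite -/v; ring.
by rewrite sgrM gtr0_sg ?mul1r // exprn_gt0.
Qed.

End Regularity.

(** * Following an unbounded connected set to infinity *)
Section Ends.
Variable R : realType.
Implicit Types (p q : plane R) (G D : set (plane R)).

Definition unbounded D := forall M : R, exists2 q, D q & M < `|q|.

Lemma not_bounded_unbounded D : ~ bounded_set D -> unbounded D.
Proof.
move=> nb M; apply: contrapT => H; apply: nb.
exists M; split; first exact: num_real.
move=> x Mx q Dq; case: (leP `|q| x) => // xq.
by exfalso; apply: H; exists q => //; exact: lt_trans Mx xq.
Qed.

Lemma norm_near p q (n : R) : `|q - p| < `|p| - n -> n < `|q|.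
Proof.
move=> h; have : `|p| <= `|q| + `|q - p|.
  by rewrite -{1}(subKr q p); exact: ler_normB.
lra.
Qed.

Lemma norm_near' p q (n : R) : `|q - p| < n - `|p| -> `|q| < n.
Proof.
move=> h; have : `|q| <= `|p| + `|q - p|.
  by rewrite -{1}(subrKC p q); exact: ler_normD.
lra.
Qed.

Lemma open_ball_set p (r : R) : 0 < r -> exists O : set (plane R),
  [/\ open O, O p & forall q, O q -> `|q - p| < r].
Proof.
move=> r0; exists [set q | `|q - p| < r]^°; split.
- exact: open_interior.
- by apply: (ball_near r0).
- by move=> q /interior_subset.
Qed.

(** Outside the ball of radius [n] the set [G] falls into open classes. A class
    that reaches beyond the sphere of radius [n + 1] must meet this sphere, or
    else its part beyond it is open and closed in [G], hence all of [G], and the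
    class is unbounded. The
    intersection of [G] with the sphere is compact, so finitely many classes
    meet it; if those contained in [D] were all bounded, [D] would be
    bounded. *)
Lemma unbounded_class G D (E : plane R -> plane R -> Prop) (n : R) : connected G ->
  (forall r : R, n < r -> compact (G `&` [set q | `|q| = r])) ->
  (forall p q, E p q -> E q p) ->
  (forall p q s, G q -> n < `|q| -> E p q -> E q s -> E p s) ->
  (forall p, G p -> n < `|p| -> exists2 r : R, 0 < r &
     forall q, G q -> `|q - p| < r -> n < `|q| /\ E p q) ->
  D `<=` G -> unbounded D ->
  (forall p q, D p -> n < `|p| -> G q -> n < `|q| -> E p q -> D q) ->
  exists p, [/\ D p, n < `|p| & unbounded [set q | [/\ G q, n < `|q| & E p q]]].
Proof.
move=> cG cptG sym tr loc DG unbD satD.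
apply: contrapT => Hno.
have bdd p : D p -> n < `|p| -> exists M : R, forall q, G q -> n < `|q| -> E p q -> `|q| <= M.
  move=> Dp np; apply: contrapT => H; apply: Hno; exists p; split=> // M.
  apply: contrapT => H'; apply: H; exists M => q Gq nq Epq.
  by case: (leP `|q| M) => // Mq; exfalso; apply: H'; exists q.
have refl p : G p -> n < `|p| -> E p p.
  move=> Gp np; have [r r0 Hr] := loc p Gp np.
  by have [] := Hr p Gp ltac:(by rewrite subrr normr0).
pose K := G `&` [set q | `|q| = n + 1].
have nn1 : n < n + 1 by rewrite ltrDl.
have meet q : D q -> n + 1 < `|q| -> exists2 x, K x & E q x.
  move=> Dq nq; apply: contrapT => Hmeet.
  have nq' : n < `|q| := lt_trans nn1 nq.
  pose B x := n + 1 < `|x| /\ E q x.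
  have H : forall x y, G x -> G y -> (B x <-> B y).
    apply: (connected_one_class (E := fun x y => B x <-> B y) cG).
    - by move=> x y _ _ [h1 h2]; split.
    - by move=> x y z _ _ _ [h1 h2] [h3 h4]; split; auto.
    move=> x Gx; case: (ltrgtP (n + 1) `|x|) => nx.
    - have [r r0 Hr] := loc x Gx (lt_trans nn1 nx).
      have r'0 : 0 < Num.min r (`|x| - (n + 1)) by rewrite lt_min r0 subr_gt0.
      have [V [oV Vx HV]] := open_ball_set x r'0.
      exists V; split=> // y Gy /HV; rewrite lt_min => /andP[yr yn].
      have [ny Exy] := Hr y Gy yr; have ny' := norm_near yn.
      split=> -[h1 h2]; split=> //.
        by apply: (tr _ x) => //; exact: lt_trans nx.
      by apply: (tr _ y) => //; exact: sym.
    - have r0 : 0 < (n + 1) - `|x| by rewrite subr_gt0.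
      have [V [oV Vx HV]] := open_ball_set x r0.
      exists V; split=> // y Gy /HV yn; have ny := norm_near' yn.
      by split=> -[h1 h2]; [move: h1; rewrite ltNge ltW|move: h1; rewrite ltNge ltW].
    - have [|r r0 Hr] := loc x Gx; first by rewrite -nx.
      have [V [oV Vx HV]] := open_ball_set x r0.
      exists V; split=> // y Gy /HV yr; have [ny Exy] := Hr y Gy yr.
      split=> -[h1 h2]; first by move: h1; rewrite nx ltxx.
      exfalso; apply: Hmeet; exists x; first by split.
      by apply: (tr _ y) => //; exact: sym.
  have [M HM] := bdd q Dq nq'.
  have [x Dx Mx] := unbD M.
  have [_ Eqx] : B x by apply/(H q x (DG _ Dq) (DG _ Dx)); split=> //; apply: refl => //; exact: DG.
  have [|nx] := leP `|x| n; last by have := HM x (DG _ Dx) nx Eqx; rewrite leNgt Mx.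
  move=> nx; have Bx : B x.
    by apply/(H q x (DG _ Dq) (DG _ Dx)); split=> //; apply: refl => //; exact: DG.
  by have [] := Bx; rewrite ltNge (le_trans nx) // ltW.
have cK : compact K by apply: cptG.
(* Compactness in the form of near coverings: a bound valid near each point of
   the sphere is valid on all of it. *)
pose P (M : R) (x : plane R) := G x -> forall q, D q -> n < `|q| -> E q x -> `|q| <= M.
have cover : forall x, K x -> \forall y \near x & M \near +oo%R, P M y.
  move=> x [Gx nx] /=.
  have nx' : n < `|x| by rewrite nx.
  have [r r0 Hr] := loc x Gx nx'.
  have [M HM] : exists M : R, forall q, D q -> n < `|q| -> E q x -> `|q| <= M.
    have [Dx|nDx] := pselect (D x).
      have [M HM] := bdd x Dx nx'; exists M => q Dq nq Eqx.
      by apply: HM => //; [exact: DG|exact: sym].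
    by exists 0 => q Dq nq Eqx; exfalso; apply: nDx; exact: satD Eqx.
  exists ([set q | `|q - x| < r], [set M' | M < M']).
    split; first by apply: (ball_near r0).
    by exists M; split => //; exact: num_real.
  move=> [y M'] /= [yr MM'] Gy q Dq nq Eqy.
  have [ny Exy] := Hr y Gy yr.
  apply: le_trans (ltW MM'); apply: HM => //.
  by apply: (tr _ y) => //; exact: sym.
have [M0 [_ HM0]] := (compact_near_coveringP K).1 cK R (pinfty_nbhs R) P _ cover.
pose M := Num.max (M0 + 1) (n + 1).
have [q Dq Mq] := unbD M.
have [x [Gx nx] Eqx] : exists2 x, K x & E q x.
  by apply: meet => //; apply: le_lt_trans Mq; rewrite le_max lexx orbT.
have nq : n < `|q|.
  by apply: lt_trans nn1 _; apply: le_lt_trans Mq; rewrite le_max lexx orbT.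
have := HM0 (M0 + 1) ltac:(by rewrite ltrDl) x (conj Gx nx) Gx q Dq nq Eqx.
rewrite leNgt => /negP; apply.
by apply: le_lt_trans Mq; rewrite le_max lexx.
Qed.

(** Unbounded classes at level [n] contain unbounded classes at level [n + 1], so
    a nested sequence of them can be chosen; its representatives leave every
    ball and consecutive ones are equivalent. *)
Lemma unbounded_chain G (E : nat -> plane R -> plane R -> Prop) : connected G ->
  unbounded G ->
  (forall r : R, 0 < r -> compact (G `&` [set q | `|q| = r])) ->
  (forall n p q, E n p q -> E n q p) ->
  (forall n p q s, G q -> n%:R < `|q| -> E n p q -> E n q s -> E n p s) ->
  (forall n p, G p -> n%:R < `|p| -> exists2 r : R, 0 < r &
     forall q, G q -> `|q - p| < r -> n%:R < `|q| /\ E n p q) ->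
  (forall n p q, E n.+1 p q -> E n p q) ->
  exists p : nat -> plane R, forall n, [/\ G (p n), n%:R < `|p n| & E n (p n) (p n.+1)].
Proof.
move=> cG unbG cptG sym tr loc sub.
pose good n p := [/\ G p, n%:R < `|p| & unbounded [set q | [/\ G q, n%:R < `|q| & E n p q]]].
have cptn n (r : R) : n%:R < r -> compact (G `&` [set q | `|q| = r]).
  by move=> nr; apply: cptG; apply: le_lt_trans nr; exact: ler0n.
have [p0 good0] : exists p, good 0%N p.
  have [|p [Gp np up]] := @unbounded_class G G (E 0%N) 0%:R cG (cptn 0%N)
    (sym 0%N) (tr 0%N) (loc 0%N) (fun x => id) unbG; first by [].
  by exists p; split.
have step np : exists p' : plane R, good np.1 np.2 -> good np.1.+1 p' /\ E np.1 np.2 p'.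
  case: np => n p /=; have [[Gp np up]|] := pselect (good n p); last by exists p.
  have [| |p' [[Gp' np' Epp'] np1 up']] := @unbounded_class G
     [set q | [/\ G q, n%:R < `|q| & E n p q]] (E n.+1) n.+1%:R cG (cptn n.+1)
    (sym n.+1) (tr n.+1) (loc n.+1) _ up.
  - by move=> q [].
  - move=> x y [Gx nx Epx] nx' Gy ny Exy; split => //.
      by apply: lt_trans ny; rewrite ltr_nat.
    by apply: (tr n p x) => //; exact: sub.
  by exists p' => _; split.
have [f Hf] := choice step.
pose p := fix p n := match n with 0%N => p0 | m.+1 => f (m, p m) end.
have gp n : good n (p n).
  by elim: n => [//|n IH] /=; have [] := Hf (n, p n) IH.
exists p => n; have [h1 h2 _] := gp n; split=> //.
by have [_] := Hf (n, p n) (gp n).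
Qed.

End Ends.

(** * Gluing infinitely many pieces *)
Section Concatenation.
Variable R : realType.
Implicit Types (X Y : plane R -> plane R) (p q : plane R).

Lemma lip_abs_cont (a b : R) (q : R -> plane R) : lip_on a b q ->
  absolutely_continuous_on a b q.
Proof.
move=> [L HL] e e0.
have L1 : 0 < `|L| + 1 by rewrite ltr_wpDl.
exists (e / (`|L| + 1)); first by rewrite divr_gt0.
move=> n x y Hxy _ Hs.
apply: (@le_lt_trans _ _ (\sum_(i < n) (`|L| + 1) * (y i - x i))).
  apply: ler_sum => i _; have [ax xy yb] := Hxy i.
  apply: le_trans (HL _ _ _ _) _; [by rewrite yb (le_trans ax)|by rewrite ax (le_trans xy)|].
  rewrite (ger0_norm (x := y i - x i)) ?subr_ge0 // ler_wpM2r ?subr_ge0 //.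
  by rewrite (le_trans (ler_norm L)) // lerDl.
by rewrite -mulr_sumr mulrC -ltr_pdivlMr.
Qed.

Lemma abs_cont_left_bounded (a b : R) (q : R -> plane R) : a < b ->
  absolutely_continuous_on a b q ->
  exists2 d : R, 0 < d & forall t, a <= t -> t < b -> b - t < d -> `|q t| <= `|q b| + 1.
Proof.
move=> ab /(_ 1 ltr01)[d d0 H]; exists d => // t at_ tb td.
have := H 1%N (fun _ => t) (fun _ => b) _ _ _; rewrite !big_ord1.
move=> /(_ _ _ td) Hq.
have {}Hq : `|q b - q t| < 1.
  apply: Hq; first by move=> _; split=> //; exact: ltW.
  by move=> i j _ _ _; rewrite (ord1 i) (ord1 j).
have -> : q t = q b - (q b - q t) by rewrite subKr.
by apply: le_trans (ler_normB _ _) _; rewrite lerD2l ltW.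
Qed.

(** The [n]-th piece of the concatenation stays outside the ball of radius [n],
    so the concatenation tends to infinity as time tends to the sum of the
    durations. When this sum is finite no extension exists, because a solution
    on a longer interval would be bounded on the left of it. *)
Lemma unbounded_of_steering_chain X Y (z : nat -> plane R) :
  (forall n, steer X Y [set q | n%:R < `|q|] (z n) (z n.+1)) -> switched_unbounded X Y.
Proof.
move=> Hst.
have /choice[c Hc] : forall n, exists c : R * (R -> R) * (R -> plane R),
  [/\ 0 < c.1.1, c.2 0 = z n, c.2 c.1.1 = z n.+1 &
   steers_by X Y [set q | n%:R < `|q|] c.1.2 c.1.1 c.2].
  by move=> n; have [tau [u [q H]]] := Hst n; exists (tau, u, q).
pose tau n := (c n).1.1; pose us n := (c n).1.2; pose qs n := (c n).2.
have tau0 n : 0 < tau n by have [] := Hc n.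
have qs0 n : qs n 0 = z n by have [] := Hc n.
have qs1 n : qs n (tau n) = z n.+1 by have [] := Hc n.
have Hs n : steers_by X Y [set q | n%:R < `|q|] (us n) (tau n) (qs n) by have [] := Hc n.
pose T := fix T n : R := match n with 0%N => 0 | m.+1 => T m + tau m end.
have TS n : T n.+1 = T n + tau n by [].
have TltS n : T n < T n.+1 by rewrite TS ltrDl.
have Tle n m : (n <= m)%N -> T n <= T m.
  elim: m => [|m IH]; first by rewrite leqn0 => /eqP ->.
  rewrite leq_eqVlt => /orP[/eqP -> //|]; rewrite ltnS => /IH h.
  by apply: le_trans h _; exact: ltW.
have T0 n : 0 <= T n by exact: (Tle 0%N).
have piece m t : 0 <= t -> t < T m -> exists2 n, (n < m)%N & T n <= t < T n.+1.
  move=> t0; elim: m => [|m IH]; first by rewrite ltNge t0.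
  move=> tm; case: (ltP t (T m)) => h.
    by have [n nm Hn] := IH h; exists n => //; exact: ltnW.
  by exists m => //; rewrite h.
have Tuniq n m t : T n <= t < T n.+1 -> T m <= t < T m.+1 -> n = m.
  move=> /andP[a1 a2] /andP[b1 b2]; case: (ltngtP n m) => // h.
    by have := lt_le_trans a2 (le_trans (Tle _ _ h) b1); rewrite ltxx.
  by have := lt_le_trans b2 (le_trans (Tle _ _ h) a1); rewrite ltxx.
(* The number of the piece in progress; 0 outside the interval of definition. *)
have [idx Hidx] : exists idx : R -> nat, [/\ forall t n, T n <= t < T n.+1 -> idx t = n &
    forall t, ~ (exists n, T n <= t < T n.+1) -> idx t = 0%N].
  have /choice[f Hf] : forall t, exists n, (forall m, T m <= t < T m.+1 -> n = m) /\
      (~ (exists n, T n <= t < T n.+1) -> n = 0%N).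
    move=> t; have [[n Hn]|H] := pselect (exists n, T n <= t < T n.+1).
      exists n; split; first by move=> m; exact: Tuniq.
      by move=> H; exfalso; apply: H; exists n.
    by exists 0%N; split=> // m Hm; exfalso; apply: H; exists m.
  by exists f; split=> t; have [h1 h2] := Hf t; [move=> n; exact: h1|exact: h2].
have [idxE idx0] := Hidx.
pose u t := us (idx t) (t - T (idx t)).
pose q t := qs (idx t) (t - T (idx t)).
have qE n t : T n <= t <= T n.+1 -> q t = qs n (t - T n).
  move=> /andP[h1]; rewrite le_eqVlt => /orP[/eqP ->|h2].
    rewrite /q (idxE _ n.+1) ?lexx ?TltS // subrr qs0 TS addrC addKr.
    by rewrite qs1.
  by rewrite /q (idxE _ n) // h1 h2.
have uE n t : T n <= t < T n.+1 -> u t = us n (t - T n).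
  by move=> h; rewrite /u (idxE _ n).
have lipq n : lip_on 0 (T n) q.
  elim: n => [|n IH].
    exists 0 => s t; rewrite /= => /andP[s0 s1] /andP[t0 t1].
    have -> : s = t by apply/eqP; rewrite eq_le (le_trans s1) ?(le_trans t1).
    by rewrite !subrr normr0 mul0r.
  apply: lip_on_glue IH _; have [_ _ _ lq _] := Hs n.
  have := lip_on_shift (T n) lq; rewrite add0r addrC -TS.
  by apply: lip_on_ext => t; exact: qE.
have big n t : T n <= t -> (exists m, t < T m) -> n%:R < `|q t|.
  move=> nt [m tm]; have t0 : 0 <= t := le_trans (T0 n) nt.
  have [k km Hk] := piece m t t0 tm; have /andP[k1 k2] := Hk.
  have nk : (n <= k)%N.
    by rewrite leqNgt; apply/negP => kn; have := lt_le_trans k2 (le_trans (Tle _ _ kn) nt); rewrite ltxx.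
  rewrite (qE k) ?k1 ?ltW //; apply: (@le_lt_trans _ _ k%:R); first by rewrite ler_nat.
  have [_ _ Uq _ _] := Hs k; apply: Uq.
  by rewrite subr_ge0 k1 /= lerBlDr addrC -TS ltW.
pose Tinf := ereal_sup (range (fun n => (T n)%:E)).
have TinfP t : (t%:E < Tinf)%E <-> exists m, t < T m.
  split; first by move=> /ereal_sup_gt[_ [m _ <-]]; rewrite lte_fin; exists m.
  move=> [m tm]; apply: (@lt_le_trans _ _ (T m)%:E); first by rewrite lte_fin.
  by apply: ereal_sup_ubound; exists m.
have TltTinf n : ((T n)%:E < Tinf)%E by apply/TinfP; exists n.+1.
have meas_u : measurable_fun setT u.
  pose A n := `[T n, T n.+1[%classic.
  (* The pieces of the half line, together with the rest, cover the line. *)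
  pose F n := match n with 0%N => ~` (\bigcup_n A n) | m.+1 => A m end.
  have mA n : measurable (A n) by exact: measurable_itv.
  have mF n : measurable (F n).
    case: n => [|n]; last exact: mA.
    by apply: measurableC; apply: bigcup_measurable => n _; exact: mA.
  have mus n : measurable_fun setT (fun t : R => us n (t - T n)).
    apply: measurableT_comp; first by have [] := Hs n.
    by apply: measurable_realfun.measurable_funB => //; exact: measurable_cst.
  have -> : setT = \bigcup_n F n.
    apply/seteqP; split=> // t _.
    have [[n _ An]|nA] := pselect ((\bigcup_n A n) t); first by exists n.+1.
    by exists 0%N.
  apply/(measurable_fun_bigcup _ mF) => -[|n] /=.
    apply: eq_measurable_fun (measurable_funS _ _ (mus 0%N)) => // t; rewrite inE => nA.
    rewrite /u idx0 // => -[n Hn]; apply: nA; exists n => //; by rewrite /A /= in_itv.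
  apply: eq_measurable_fun (measurable_funS _ _ (mus n)) => // t; rewrite inE /A /= in_itv /= => h.
  by rewrite (uE n).
exists (z 0%N), u, Tinf, q; split.
- split; first exact: measurable_funS meas_u.
  by move=> t _; have [_ h _ _ _] := Hs (idx t); exact: h.
- split; first exact: TltTinf 0%N.
    split.
    + by rewrite (qE 0%N) ?lexx ?T0 //= subr0.
    + move=> t [t0 /TinfP[m tm]]; apply: lip_abs_cont.
      have [L HL] := lipq m; exists L => x y /andP[x0 x1] /andP[y0 y1].
      by apply: HL; rewrite ?x0 ?y0 /= ?(le_trans x1 (ltW tm)) ?(le_trans y1 (ltW tm)).
    + have /choice[D HD] : forall n, exists D : set R, countable D /\ forall t, 0 < t < tau n -> ~ D t ->
        is_derive (t : R^o) 1 (qs n) (us n t *: X (qs n t) + (1 - us n t) *: Y (qs n t)).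
        by move=> n; have [_ _ _ _ [D cD HD]] := Hs n; exists D.
      pose bad := \bigcup_n ([set T n] `|` ((fun s => s + T n) @` D n)).
      have cbad : countable bad.
        apply: bigcup_countable => // n _; apply: countable_setU => //.
        by have [cD _] := HD n; exact: sub_countable (card_image_le _ _) cD.
      exists bad; split.
      * by apply: countable_measurable cbad => t; exact: measurable_set1.
      * exact: countable_lebesgue_measure0.
      move=> t /= H; apply: contrapT => nbad; apply: H => -[t0 /TinfP[m tm]] t0'.
      have [n nm /andP[n1 n2]] := piece m t t0 tm.
      have n1' : T n < t.
        rewrite lt_neqAle n1 andbT; apply/eqP => E; apply: nbad; exists n => //; by left.
      have tin : T n <= t < T n.+1 by rewrite n1.
      have E : \forall s \near t, qs n (s - T n) = q s.
        have := @near_itv R (T n) (T n.+1) t; rewrite n1' n2 => /(_ isT).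
        by apply: filterS => s /andP[s1 s2]; rewrite (qE n) // !ltW.
      apply: near_eq_is_derive E _.
      rewrite (uE n t tin) (qE n t) ?n1 ?ltW //.
      apply: is_derive_shiftr; have [_ H] := HD n; apply: H.
        by rewrite subr_gt0 n1' /= ltrBlDr addrC -TS.
      by move=> Dn; apply: nbad; exists n => //; right; exists (t - T n) => //; rewrite subrK.
  move=> T' q' TT' Eq [_ ac _].
  case ETinf : Tinf => [r| |]; last 2 first.
  + by move: TT'; rewrite ETinf ltNge leey.
  + by have := TltTinf 0%N; rewrite ETinf ltNge leNye.
  have Tr n : T n < r by have := TltTinf n; rewrite ETinf lte_fin.
  have r0 : 0 < r by exact: (Tr 0%N).
  have [|d d0 Hd] := abs_cont_left_bounded r0 (ac r _).
    by split; [exact: ltW|rewrite -ETinf].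
  have [N HN] : exists N : nat, `|q' r| + 1 < N%:R.
    by exists (Num.bound (`|q' r| + 1)); apply: archi_boundP; rewrite addr_ge0.
  pose t := Num.max (T N) (r - d / 2).
  have tr : t < r by rewrite gt_max Tr /= ltrBlDr ltrDl divr_gt0.
  have t0 : 0 <= t by rewrite le_max T0.
  have tin : times Tinf t by split=> //; rewrite ETinf lte_fin.
  have := Hd t t0 tr; rewrite Eq //.
  have [m tm] : exists m, t < T m by apply/TinfP; case: tin.
  have HNt : T N <= t by rewrite le_max lexx.
  have B := big N t HNt ltac:(by exists m).
  have td : r - t < d.
    have : r - d / 2 <= t by rewrite le_max lexx orbT.
    clear -d0; lra.
  move=> /(_ td); rewrite leNgt => /negP; apply; exact: lt_trans HN B.
- have large (M : R) : exists N : nat, M < N%:R.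
    exists (Num.bound `|M|); apply: le_lt_trans (ler_norm M) _; exact: archi_boundP.
  case ETinf : Tinf => [r| |] /=; last first.
  + by have := TltTinf 0%N; rewrite ETinf ltNge leNye.
  + apply/cvgryPgt => M; have [N HN] := large M.
    exists (T N); split; first exact: num_real.
    move=> t Nt; apply: lt_trans HN _; apply: big; first exact: ltW.
    by apply/TinfP; rewrite ETinf ltry.
  apply/cvgryPgt => M; have [N HN] := large M.
  have Tr : T N < r by have := TltTinf N; rewrite ETinf lte_fin.
  near=> t; apply: lt_trans HN _; apply: big.
    by near: t; apply: nbhs_left_ge.
  by apply/TinfP; rewrite ETinf lte_fin; near: t; exact: nbhs_left_lt.
Unshelve. all: by end_near. Qed.

End Concatenation.

(** * The switched system is unbounded *)
Section Final.
Variable R : realType.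
Implicit Types (X Y : plane R -> plane R) (p q z : plane R) (f : plane R -> R).

(** Nearby zeros lie on the arc given by the implicit function theorem, whose
    part between [p] and [z] is a connected subset of the locus. The clamp
    parametrises this part by the whole line. *)
Lemma zero_in_component f p U : C1 f -> f p = 0 -> grad f p != 0 -> nbhs p U ->
  exists2 r : R, 0 < r & forall z, `|z - p| < r -> f z = 0 ->
    connected_component ([set q | f q = 0] `&` U) p z.
Proof.
move=> Cf fp n0 NU.
have [del [r [L [gam [d0 r0 [g0 Hg] Hl Hz]]]]] := zero_graph Cf fp n0 NU.
exists r => // z zr fz; have [x xd Ez] := Hz z zr fz.
pose c := clamp (- `|x|) `|x|.
have xx : - `|x| <= `|x| by rewrite (le_trans _ (normr_ge0 x)) // oppr_le0.
have cd t : `|c t| < del.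
  by apply: le_lt_trans xd; rewrite ler_norml; exact: clamp_in.
have cg : continuous (gam \o c).
  apply: (@lip_continuous _ _ _ `|L|) => s t /=.
  apply: le_trans (Hl _ _ (cd s) (cd t)) _.
  apply: le_trans (_ : `|L| * `|c s - c t| <= _).
    by rewrite ler_wpM2r // ler_norm.
  by rewrite ler_wpM2l // clamp_lip.
have conn : connected ((gam \o c) @` setT).
  apply: connected_continuous_connected; last exact: continuous_subspaceT.
  by apply/connected_intervalP.
apply: (connected_component_max _ _ conn).
- by exists 0 => //=; rewrite /c clamp_id // oppr_le0 normr_ge0.
- by move=> _ [t _ <-] /=; have [h1 h2 _] := Hg _ (cd t).
- by exists x => //=; rewrite /c clamp_id ?Ez // -ler_norml.
Qed.

Lemma closed_of_approx (A : set (plane R)) :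
  (forall q, (forall r : R, 0 < r -> exists2 z, A z & `|z - q| < r) -> A q) -> closed A.
Proof.
move=> H q clq; apply: H => r r0.
have [z [Az zr]] := clq [set z | `|z - q| < r] (ball_near r0 (fun _ => id)).
by exists z.
Qed.

End Final.

Theorem theorem11 (R : realType) (X Y : plane R -> plane R)
  (smoothX : smooth X) (smoothY : smooth Y)
  (X0 : X 0 = 0) (Y0 : Y 0 = 0)
  (gasX : globally_asymptotically_stable X)
  (gasY : globally_asymptotically_stable Y)
  (G1 : forall p, p != 0 -> detXY X Y p = 0 -> grad (detXY X Y) p != 0)
  (G3 : forall p, p != 0 -> detXY X Y p = 0 ->
     dot (grad (detXY X Y) p) (X p) = 0 ->
     lie X (lie X (detXY X Y)) p != 0)
  (unbounded_inverse : exists2 C : set (plane R),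
     inverse_component X Y C & ~ bounded_set C) :
  switched_unbounded X Y.
Proof.
have [C [[p0 Sp0 CE] Copp] nbC] := unbounded_inverse.
have {nbC} unbC := not_bounded_unbounded nbC.
set Q := detXY X Y in G1 G3.
pose S := collinear_locus X Y `\ 0.
have sQ : scalar_smooth Q := scalar_smooth_det smoothX smoothY.
have shX := scalar_smooth_lie smoothX sQ; have shY := scalar_smooth_lie smoothY sQ.
have CQ := scalar_smooth_C1 sQ; have ChX := scalar_smooth_C1 shX; have ChY := scalar_smooth_C1 shY.
have CX := smooth_C1field smoothX; have CY := smooth_C1field smoothY.
have QE q : Q q = det2 (X q) (Y q) by exact: detXY2.
have SP q : S q <-> Q q = 0 /\ q != 0.
  by split=> [[h1 /eqP h2]|[h1 /eqP h2]]; split.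
have loc q : S q -> exists2 r : R, 0 < r & forall z, `|z - q| < r -> Q z = 0 ->
    connected_component S q z.
  move=> /SP[Qq q0].
  have N0 : nbhs q (~` [set 0]).
    have q0' : 0 < `|q| by rewrite normr_gt0.
    apply: (ball_near q0') => z zq z0; move: zq.
    by rewrite z0 sub0r normrN ltxx.
  exact: zero_in_component CQ Qq (G1 q q0 Qq) N0.
have CS q : C q -> S q by rewrite CE; exact: connected_component_sub.
(* C is closed in the complement of the origin. *)
have Cnear q : S q -> (forall r : R, 0 < r -> exists2 z, C z & `|z - q| < r) -> C q.
  move=> Sq H; have [r r0 Hr] := loc q Sq; have [z Cz zq] := H r r0.
  have [Qz _] := (SP z).1 (CS z Cz); have qz := Hr z zq Qz.
  rewrite CE; rewrite CE in Cz; apply: connected_component_trans Cz _.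
  exact: connected_component_sym.
have NC p : C p -> nbhs p [set q | Q q = 0 -> C q].
  move=> Cp; have [r r0 Hr] := loc p (CS p Cp).
  apply: (ball_near r0) => q qr Qq; have := Hr q qr Qq.
  by move: Cp; rewrite CE; exact: connected_component_trans.
have opp p : C p -> opposed X Y p by move=> /Copp[_ [k k0 E]]; exists k.
pose trv z := lie X Q z != 0.
have LC p U : C p -> nbhs p U -> exists2 r : R, 0 < r & forall z1 z2,
    `|z1 - p| < r -> `|z2 - p| < r -> C z1 -> C z2 -> trv z1 -> trv z2 ->
    steer X Y U z1 z2.
  move=> Cp NU; have [Qp p0'] := (SP p).1 (CS p Cp).
  have HW q : (Q q = 0 -> C q) -> Q q = 0 -> opposed X Y q.
    by move=> H /H; exact: opp.
  have CQ0 z : C z -> Q z = 0 by move=> /CS /SP[].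
  have [hp|hp] := eqVneq (lie X Q p) 0; last first.
    have [r r0 Hr] := transversal_local CX CY CQ QE Qp hp (NC p Cp) HW NU.
    by exists r => // z1 z2 h1 h2 c1 c2 _ _; apply: Hr => //; exact: CQ0.
  have [k k0 Yp] := opp p Cp.
  have Xp0 : X p != 0 by have [] := Copp p Cp.
  have [r r0 Hr] := @tangency_local R X Y Q (lie X Q) (lie Y Q) p U _ CX CY CQ ChX ChY QE
    (fun q => erefl) (fun q => erefl) (scalar_Ck_cont (scalar_smooth_lie smoothX shX 0%N))
    (scalar_Ck_cont (scalar_smooth_lie smoothY shY 0%N)) Qp hp (G1 p p0' Qp) (G3 p p0' Qp hp)
    (lie_lie_sg smoothX smoothY Qp hp Xp0 k0 Yp) (NC p Cp) HW NU.
  by exists r => // z1 z2 h1 h2 c1 c2 t1 t2; apply: Hr => //; exact: CQ0.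
have dense p (r : R) : C p -> 0 < r -> exists z, [/\ C z, trv z & `|z - p| < r].
  move=> Cp r0; have [Qp p0'] := (SP p).1 (CS p Cp).
  have [hp|hp] := eqVneq (lie X Q p) 0; last first.
    by exists p; split=> //; rewrite subrr normr0.
  have NB : nbhs p ([set q | Q q = 0 -> C q] `&` [set q | `|q - p| < r]).
    by apply: filterI; [exact: NC|exact: (ball_near r0)].
  have [z [_ /= [[[h1 h2] _] [Qz _] hz _ _]]] := tangency_link_sg CX CQ ChX (fun q => erefl)
    (scalar_Ck_cont (scalar_smooth_lie smoothX shX 0%N)) Qp hp (G3 p p0' Qp hp) (G1 p p0' Qp) NB.
  exists z; split=> //; first exact: h1.
  by apply/eqP => E; move: hz; rewrite E mulr0 ltxx.
pose U (n : nat) := [set q : plane R | n%:R < `|q|].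
have NU n p : n%:R < `|p| -> nbhs p (U n).
  move=> np; apply: (@ball_near _ _ _ (`|p| - n%:R)); first by rewrite subr_gt0.
  by move=> q; exact: norm_near.
(* Points near p and p' can be steered both ways; p and p' themselves may be
   tangency points, from which steering can fail. *)
pose E (n : nat) p p' := exists2 r : R, 0 < r & forall z z', C z -> C z' -> trv z -> trv z' ->
  `|z - p| < r -> `|z' - p'| < r -> steer X Y (U n) z z' /\ steer X Y (U n) z' z.
have [||||||p Hp] := @unbounded_chain R C E _ unbC.
- by rewrite CE; exact: component_connected.
- move=> r r0; apply: bounded_closed_compact.
    exists r; split; first exact: num_real.
    by move=> x rx q [_ /= ->]; exact: ltW.
  apply: closed_of_approx => q H.
  have nq : `|q| = r.
    apply/eqP; rewrite -subr_eq0 -normr_le0; apply/ler_addgt0Pr => e e0.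
    have [z [_ /= <-] zq] := H e e0; rewrite add0r.
    by apply: le_trans (ler_dist_dist _ _) _; rewrite distrC ltW.
  have Qq : Q q = 0.
    apply/eqP; rewrite -normr_le0; apply/ler_addgt0Pr => e e0; rewrite add0r.
    have [d d0 Hd] := near_ball (near_cont e0 (C1_cont CQ (x := q))).
    have [z [/CS /SP[Qz _] _] zq] := H d d0.
    by have := Hd z zq; rewrite Qz sub0r normrN.
  split=> //; apply: Cnear; first by apply/SP; split=> //; rewrite -normr_gt0 nq.
  by move=> d /H[z [Cz _] zq]; exists z.
- move=> n p q [r r0 H]; exists r => // z z' Cz Cz' tz tz' h1 h2.
  by have [s1 s2] := H z' z Cz' Cz tz' tz h2 h1.
- move=> n p q s Cq nq [r1 r10 H1] [r2 r20 H2].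
  have r0 : 0 < Num.min r1 r2 by rewrite lt_min r10 r20.
  have [y [Cy ty]] := dense q _ Cq r0; rewrite lt_min => /andP[y1 y2].
  exists (Num.min r1 r2) => // z z' Cz Cz' tz tz'.
  rewrite !lt_min => /andP[z1 _] /andP[_ z2].
  have [s1 s2] := H1 z y Cz Cy tz ty z1 y1.
  have [s3 s4] := H2 y z' Cy Cz' ty tz' y2 z2.
  by split; [exact: steer_trans s1 s3|exact: steer_trans s4 s2].
- move=> n p Cp np; have [r r0 Hr] := LC p (U n) Cp (NU n p np).
  have np0 : 0 < `|p| - n%:R by rewrite subr_gt0.
  exists (Num.min (r / 2) (`|p| - n%:R)); first by rewrite lt_min np0 divr_gt0.
  move=> q Cq; rewrite lt_min => /andP[q1 q2]; split; first exact: norm_near q2.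
  exists (r / 2); first by rewrite divr_gt0.
  move=> z z' Cz Cz' tz tz' h1 h2.
  have z1 : `|z - p| < r by clear -h1 r0; lra.
  have z2 : `|z' - p| < r.
    by apply: le_lt_trans (ler_distD q _ _) _; clear -h2 q1; lra.
  by split; apply: Hr.
- move=> n p q [r r0 H]; exists r => // z z' Cz Cz' tz tz' h1 h2.
  have sub : U n.+1 `<=` U n by move=> x; apply: lt_trans; rewrite ltr_nat.
  by have [s1 s2] := H z z' Cz Cz' tz tz' h1 h2; split; exact: steer_sub sub _.
have /choice[rho Hrho] : forall n, exists r : R, 0 < r /\ forall z z', C z -> C z' -> trv z -> trv z' ->
  `|z - p n| < r -> `|z' - p n.+1| < r -> steer X Y (U n) z z'.
  move=> n; have [_ _ [r r0 H]] := Hp n; exists r; split=> // z z' Cz Cz' tz tz' h1 h2.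
  by have [] := H z z' Cz Cz' tz tz' h1 h2.
(* z n has to be close to p n for the relations at levels n - 1 and n. *)
have /choice[z Hz] : forall n, exists z, [/\ C z, trv z & `|z - p n| < Num.min (rho n) (rho n.-1)].
  move=> n; have [Cp _ _] := Hp n; apply: dense => //.
  by rewrite lt_min; have [-> _] := Hrho n; have [-> _] := Hrho n.-1.
apply: (@unbounded_of_steering_chain _ _ _ z) => n.
have [_ H] := Hrho n; have [C1' t1] := Hz n; have [C2' t2] := Hz n.+1.
rewrite !lt_min /= => /andP[_ h2] /andP[h1 _].
exact: H.
Qed.
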